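(* Let $\mathbf A=(A_n)\in\mathcal S_{\mathcal Y}({\sf BDO}(\Gamma))$ and $A:=\mathrm{s\text{-}lim}\,A_nP_{Y_n}$. Then every limit operator of $\mathrm{Op}(\mathbf A)+P_{\Gamma'}$ is one of the following: (a) the identity operator $I$; (b) an operator $R_{v^*}^{-1}AR_{v^*}$ with $v^*\in\Gamma$; (c) a limit operator of $A$; (d) an operator of the form \[\mathrm{s\text{-}lim}_{j\to\infty}R_{w_*}^{-1}R_{\eta_j}^{-1}A_{k_j}P_{Y_{k_j}}R_{\eta_j}R_{w_*}+(P_{\Gamma'})_g,\] where $(k_j)$ is a strictly increasing sequence of positive integers, $\eta_j\in(\partial_\Omega Y_{k_j})^{-1}$, $w_*\in\Gamma$, $g(j)=v_{k_j}\eta_jw_*$, and the strong limit and the limit operator $(P_{\Gamma'})_g$ exist. Moreover, every operator in (b) and every operator in (c) is a limit operator of $\mathrm{Op}(\mathbf A)+P_{\Gamma'}$.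
   Context: $\Gamma$ is a countable discrete group with identity $e$. For $X\subseteq\Gamma$, $P_X$ is the orthogonal projection of $l^2(\Gamma)$ onto $l^2(X)$. For $r\in\Gamma$, $(L_ru)(t)=u(r^{-1}t)$ and $(R_ru)(t)=u(tr)$. ${\sf BDO}(\Gamma)$ is the smallest closed subalgebra of $L(l^2(\Gamma))$ containing all $L_r$ and all multiplication operators $aI$, $a\in l^\infty(\Gamma)$. $\Omega\subseteq\Gamma$ is finite, contains $e$, generates $\Gamma$ as a semigroup; $\Omega_0=\{e\}$, $\Omega_n$ = set of products of at most $n$ elements of $\Omega$. For $A\subseteq\Gamma$: $\mathrm{int}_\Omega A=\{a\in A:\Omega a\subseteq A\}$, $\partial_\Omega A=A\setminus\mathrm{int}_\Omega A$; set products and inverses are elementwise. $\mathcal Y=(Y_n)$ is an increasing sequence of finite subsets of $\Gamma$ with union $\Gamma$. $\mathcal S_{\mathcal Y}({\sf BDO}(\Gamma))$ is the smallest closed $C^*$-subalgebra of the $C^*$-algebra of bounded sequences $(A_n)$ of operators on $\mathrm{im}\,P_{Y_n}$ (componentwise operations, sup norm) containing all $(P_{Y_n}BP_{Y_n})$, $B\in{\sf BDO}(\Gamma)$; for its elements $\mathrm{s\text{-}lim}\,A_nP_{Y_n}$ exists. Fix $(v_n)$ in $\Gamma$ inflating for $Z_n:=(Y_n\cup\Omega_n)(Y_n\cup\Omega_n)^{-1}(Y_n\cup\Omega_n)$, i.e. $Z_mv_m^{-1}\cap Z_nv_n^{-1}=\emptyset$ for $m\ne n$. $\mathrm{Op}(\mathbf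 A):=\sum_nR_{v_n}A_nP_{Y_n}R_{v_n}^{-1}$ (strongly convergent) and $\Gamma':=\Gamma\setminus\bigcup_nY_nv_n^{-1}$. A sequence $h:\mathbb N\to\Gamma$ tends to infinity if for each finite $\Gamma_0$, $h(n)\notin\Gamma_0$ for large $n$. For $B\in L(l^2(\Gamma))$, $B_h$ is the limit operator of $B$ with respect to $h$ if $R_{h(m)}^{-1}BR_{h(m)}\to B_h$ and $R_{h(m)}^{-1}B^*R_{h(m)}\to B_h^*$ strongly. *)

(* Defs.v *)
From Stdlib Require Import Reals List ClassicalEpsilon.
Import ListNotations.
Open Scope R_scope.

Record C := mkC { re : R; im : R }.
Definition C0 : C := mkC 0 0.
Definition C1 : C := mkC 1 0.
Definition Cadd (a b : C) : C := mkC (re a + re b) (im a + im b).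
Definition Copp (a : C) : C := mkC (- re a) (- im a).
Definition Csub (a b : C) : C := Cadd a (Copp b).
Definition Cmul (a b : C) : C :=
  mkC (re a * re b - im a * im b) (re a * im b + im a * re b).
Definition Cconj (a : C) : C := mkC (re a) (- im a).
Definition Cnorm2 (a : C) : R := re a * re a + im a * im a.

Record group := Group {
  carrier :> Type;
  gmul : carrier -> carrier -> carrier;
  ginv : carrier -> carrier;
  gone : carrier;
  gmulA : forall x y z, gmul x (gmul y z) = gmul (gmul x y) z;
  gmul1l : forall x, gmul gone x = x;
  gmul1r : forall x, gmul x gone = x;
  gmulVl : forall x, gmul (ginv x) x = gone;
  gmulVr : forall x, gmul x (ginv x) = gone }.
Arguments gmul {g}. Arguments ginv {g}. Arguments gone {g}.

Section Defs.
Variable G : group.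

Definition countable_group : Prop := exists f : nat -> G, forall t : G, exists n, f n = t.

Definition finite_set (X : G -> Prop) : Prop := exists l : list G, forall t, X t <-> In t l.

Definition gprod (l : list G) : G := fold_right gmul gone l.

Definition generates_semigroup (Om : G -> Prop) : Prop :=
  forall t : G, exists l, l <> [] /\ Forall Om l /\ gprod l = t.

Definition OmegaN (Om : G -> Prop) (n : nat) (t : G) : Prop :=
  exists l, (length l <= n)%nat /\ Forall Om l /\ gprod l = t.

Definition int_Om (Om : G -> Prop) (A : G -> Prop) (a : G) : Prop :=
  A a /\ forall o, Om o -> A (gmul o a).
Definition bd_Om (Om : G -> Prop) (A : G -> Prop) (a : G) : Prop :=
  A a /\ ~ int_Om Om A a.

Definition Zset (Om : G -> Prop) (Y : nat -> G -> Prop) (n : nat) (t : G) : Prop :=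
  let W := fun s => Y n s \/ OmegaN Om n s in
  exists a b c, W a /\ W b /\ W c /\ t = gmul a (gmul (ginv b) c).

Definition inflating (Z : nat -> G -> Prop) (v : nat -> G) : Prop :=
  forall m n, m <> n -> forall t,
    ~ ((exists z, Z m z /\ t = gmul z (ginv (v m))) /\
       (exists z, Z n z /\ t = gmul z (ginv (v n)))).

Definition GammaPrime (Y : nat -> G -> Prop) (v : nat -> G) (t : G) : Prop :=
  ~ exists n y, Y n y /\ t = gmul y (ginv (v n)).

Definition vec := G -> C.
Definition vadd (x y : vec) : vec := fun t => Cadd (x t) (y t).
Definition vsub (x y : vec) : vec := fun t => Csub (x t) (y t).
Definition vscal (c : C) (x : vec) : vec := fun t => Cmul c (x t).
Definition vzero : vec := fun _ => C0.

Definition lsum (f : G -> R) (l : list G) : R := fold_right (fun t acc => f t + acc) 0 l.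
Definition lsumC (f : G -> C) (l : list G) : C := fold_right (fun t acc => Cadd (f t) acc) C0 l.

Definition vnorm_le (x : vec) (r : R) : Prop :=
  0 <= r /\ forall l, NoDup l -> lsum (fun t => Cnorm2 (x t)) l <= r * r.
Definition l2 (x : vec) : Prop := exists r, vnorm_le x r.

Definition has_sumC (f : G -> C) (z : C) : Prop :=
  forall eps, 0 < eps -> exists F0, NoDup F0 /\
    forall F, NoDup F -> incl F0 F -> Cnorm2 (Csub (lsumC f F) z) <= eps * eps.
Definition inner (x y : vec) (z : C) : Prop := has_sumC (fun t => Cmul (x t) (Cconj (y t))) z.

Definition op := vec -> vec.
Definition opadd (A B : op) : op := fun x => vadd (A x) (B x).
Definition opsub (A B : op) : op := fun x => vsub (A x) (B x).
Definition opscal (c : C) (A : op) : op := fun x => vscal c (A x).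
Definition opcomp (A B : op) : op := fun x => A (B x).
Definition opid : op := fun x => x.
Definition opzero : op := fun _ => vzero.

Definition linear_l2 (T : op) : Prop :=
  (forall x y, l2 x -> l2 y -> forall t, T (vadd x y) t = vadd (T x) (T y) t) /\
  (forall c x, l2 x -> forall t, T (vscal c x) t = vscal c (T x) t).
Definition op_le (T : op) (r : R) : Prop :=
  0 <= r /\ forall x s, vnorm_le x s -> vnorm_le (T x) (r * s).
Definition bounded (T : op) : Prop := linear_l2 T /\ exists M, op_le T M.
Definition op_eq (A B : op) : Prop := forall x, l2 x -> forall t, A x t = B x t.
Definition strong_lim (T : nat -> op) (S : op) : Prop :=
  forall x, l2 x -> forall eps, 0 < eps ->
    exists N, forall n, (N <= n)%nat -> vnorm_le (vsub (T n x) (S x)) eps.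
Definition is_adjoint (B S : op) : Prop :=
  forall x y, l2 x -> l2 y -> exists z, inner (B x) y z /\ inner x (S y) z.

Definition proj (X : G -> Prop) : op :=
  fun x t => if excluded_middle_informative (X t) then x t else C0.
Definition Lop (r : G) : op := fun u t => u (gmul (ginv r) t).
Definition Rop (r : G) : op := fun u t => u (gmul t r).
Definition RopInv (r : G) : op := Rop (ginv r).
Definition mulop (a : G -> C) : op := fun u t => Cmul (a t) (u t).
Definition linf (a : G -> C) : Prop := exists M, forall t, Cnorm2 (a t) <= M.

Definition closed_subalgebra (S : op -> Prop) : Prop :=
  (forall A, S A -> bounded A) /\
  (forall A B, S A -> S B -> S (opadd A B)) /\
  (forall c A, S A -> S (opscal c A)) /\
  (forall A B, S A -> S B -> S (opcomp A B)) /\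
  (forall B, bounded B ->
     (forall eps, 0 < eps -> exists A, S A /\ op_le (opsub B A) eps) -> S B).
Definition BDO (B : op) : Prop :=
  forall S : op -> Prop, closed_subalgebra S ->
    (forall r, S (Lop r)) -> (forall a, linf a -> S (mulop a)) -> S B.

(* an operator on im P_X is represented by an operator T on l^2(Gamma) with T = P_X T P_X *)
Definition compressed (X : G -> Prop) (T : op) : Prop :=
  forall x, l2 x -> forall t, T x t = proj X (T (proj X x)) t.
Definition bseq (Y : nat -> G -> Prop) (A : nat -> op) : Prop :=
  (forall n, compressed (Y n) (A n) /\ bounded (A n)) /\
  exists M, forall n, op_le (A n) M.
Definition cstar_closed (Y : nat -> G -> Prop) (S : (nat -> op) -> Prop) : Prop :=
  (forall A, S A -> bseq Y A) /\
  (forall A B, S A -> S B -> S (fun n => opadd (A n) (B n))) /\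
  (forall c A, S A -> S (fun n => opscal c (A n))) /\
  (forall A B, S A -> S B -> S (fun n => opcomp (A n) (B n))) /\
  (forall A Cs, S A ->
     (forall n, compressed (Y n) (Cs n) /\ bounded (Cs n) /\ is_adjoint (A n) (Cs n)) ->
     S Cs) /\
  (forall B, bseq Y B ->
     (forall eps, 0 < eps -> exists A, S A /\ forall n, op_le (opsub (B n) (A n)) eps) ->
     S B).
Definition SY (Y : nat -> G -> Prop) (A : nat -> op) : Prop :=
  forall S, cstar_closed Y S ->
    (forall B, BDO B -> S (fun n => opcomp (proj (Y n)) (opcomp B (proj (Y n))))) ->
    S A.

Fixpoint op_partial (Y : nat -> G -> Prop) (v : nat -> G) (A : nat -> op) (N : nat) : op :=
  match N with
  | O => opzero
  | S N' => opadd (op_partial Y v A N')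
              (opcomp (Rop (v N')) (opcomp (A N') (opcomp (proj (Y N')) (RopInv (v N')))))
  end.

Definition tends_to_infinity (h : nat -> G) : Prop :=
  forall l : list G, exists N, forall n, (N <= n)%nat -> ~ In (h n) l.
Definition is_limop (B : op) (h : nat -> G) (Bh : op) : Prop :=
  tends_to_infinity h /\ bounded Bh /\
  strong_lim (fun m => opcomp (RopInv (h m)) (opcomp B (Rop (h m)))) Bh /\
  exists Bs Bhs, bounded Bs /\ is_adjoint B Bs /\ bounded Bhs /\ is_adjoint Bh Bhs /\
    strong_lim (fun m => opcomp (RopInv (h m)) (opcomp Bs (Rop (h m)))) Bhs.
Definition limop_of (B Bh : op) : Prop := exists h, is_limop B h Bh.

End Defs.

(* Main.v *)
(** Locality: for B in BDO(G), and likewise for a sequence in S_Y(BDO(G)), the columns at y are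
    approximated, uniformly in y, by vectors carried by F y with F a fixed finite set; for a
    sequence the same vector serves every n with F y inside Y_n. This survives sums, products,
    adjoints and norm limits, and gives ||(A_n - A) delta_y|| <= e whenever F y lies in Y_n, for
    suitable F depending on e only, together with the same for the adjoints.

    Conjugation by R_h moves the n-th block of Op(A) to the set Y_n v_n^-1 h. For h tending to
    infinity there are three possibilities along a subsequence: the blocks leave every finite set,
    and only the identity on Gamma' remains; or one block, of growing index, swallows every finite
    set, so that by locality the limit is that of shifts of A, by a constant or by a sequence
    tending to infinity; or a boundary point of that block stays at bounded distance from e, while
    the inflation property pushes all other blocks away. *)

From Stdlib Require Import Reals List ClassicalEpsilon.
From Stdlib Require Import Lra Lia FunctionalExtensionality FinFun.
Require Import Defs.
Import ListNotations.
Open Scope R_scope.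

(** Strong convergence of [A_n] gives nothing uniform in y and nothing about the adjoints, while a
    limit operator needs both: the shifts move y to infinity, and the shifted adjoints must converge
    too. BDO is generated without an adjoint operation, so locality is carried for an operator and
    its adjoint side by side. Convergence is then tested on basis vectors only, which suffices under
    a uniform norm bound; for Op(A) this bound is that of the sequence, because the blocks act on
    mutually orthogonal subspaces.

    The boundary case asks for more than a limit of the whole: the block part and the projection
    onto Gamma' must converge separately. Countability and a diagonal argument make the shifted
    projections converge along a subsequence, to the projection onto some set, and the block part
    then converges to the difference. The boundary point itself comes from a word in [Om]: a walk
    from a point of the block to a point outside leaves the block at one of finitely many fixed
    displacements, one of which recurs infinitely often. *)

(** * Complex numbers and their modulus *)

Lemma C_ext (a b : C) : re a = re b -> im a = im b -> a = b.
Proof. destruct a, b; simpl; intros; subst; reflexivity. Qed.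

Lemma C_ring_theory : ring_theory C0 C1 Cadd Cmul Csub Copp eq.
Proof.
  constructor; intros; try reflexivity; apply C_ext; simpl; ring.
Qed.
Add Ring C_ring : C_ring_theory.

Definition Cabs (z : C) : R := sqrt (Cnorm2 z).

Lemma Cnorm2_pos z : 0 <= Cnorm2 z.
Proof. unfold Cnorm2; nra. Qed.

Lemma Cabs_pos z : 0 <= Cabs z.
Proof. apply sqrt_pos. Qed.

Lemma Cabs_sqr z : Cabs z * Cabs z = Cnorm2 z.
Proof. apply sqrt_sqrt, Cnorm2_pos. Qed.

Lemma le_of_sqr_le a b : 0 <= b -> a * a <= b * b -> a <= b.
Proof. intros; nra. Qed.

Lemma Cabs_le_iff z e : 0 <= e -> (Cabs z <= e <-> Cnorm2 z <= e * e).
Proof.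
  intros He; rewrite <- Cabs_sqr; generalize (Cabs_pos z); split; intros; nra.
Qed.

Lemma Cabs_of_norm2 z e : 0 <= e -> Cnorm2 z = e * e -> Cabs z = e.
Proof. intros He H; unfold Cabs; rewrite H; apply sqrt_square; exact He. Qed.

Lemma Cabs_mul a b : Cabs (Cmul a b) = Cabs a * Cabs b.
Proof.
  apply Cabs_of_norm2.
  - apply Rmult_le_pos; apply Cabs_pos.
  - transitivity (Cnorm2 a * Cnorm2 b).
    + unfold Cnorm2; simpl; ring.
    + rewrite <- !Cabs_sqr; ring.
Qed.

Lemma Cabs_conj a : Cabs (Cconj a) = Cabs a.
Proof. unfold Cabs, Cnorm2; simpl; f_equal; ring. Qed.

Lemma Cabs_opp a : Cabs (Copp a) = Cabs a.
Proof. unfold Cabs, Cnorm2; simpl; f_equal; ring. Qed.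

Lemma Cabs_0 : Cabs C0 = 0.
Proof. apply Cabs_of_norm2; unfold Cnorm2; simpl; lra. Qed.

Lemma Cabs_1 : Cabs C1 = 1.
Proof. apply Cabs_of_norm2; unfold Cnorm2; simpl; lra. Qed.

Lemma Cabs_triangle a b : Cabs (Cadd a b) <= Cabs a + Cabs b.
Proof.
  pose proof (Cabs_pos a); pose proof (Cabs_pos b).
  apply Cabs_le_iff; [lra|].
  assert (H1 : re a * re b + im a * im b <= Cabs a * Cabs b).
  { apply le_of_sqr_le; [apply Rmult_le_pos; assumption|].
    replace (Cabs a * Cabs b * (Cabs a * Cabs b))
      with ((Cabs a * Cabs a) * (Cabs b * Cabs b)) by ring.
    rewrite !Cabs_sqr; unfold Cnorm2.
    pose proof (Rle_0_sqr (re a * im b - im a * re b)) as H2; unfold Rsqr in H2; nra. }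
  replace (Cnorm2 (Cadd a b))
    with (Cnorm2 a + Cnorm2 b + 2 * (re a * re b + im a * im b))
    by (unfold Cnorm2; simpl; ring).
  rewrite <- !Cabs_sqr; nra.
Qed.

Lemma Cabs_sub_sym a b : Cabs (Csub a b) = Cabs (Csub b a).
Proof. rewrite <- Cabs_opp; f_equal; ring. Qed.

Lemma Cabs_eq0 z : Cabs z <= 0 -> z = C0.
Proof.
  intros H; pose proof (Cabs_pos z).
  assert (Cnorm2 z = 0) by (rewrite <- Cabs_sqr; nra).
  unfold Cnorm2 in *; apply C_ext; simpl; nra.
Qed.

Lemma Rle_of_le_eps a b : (forall e, 0 < e -> a <= b + e) -> a <= b.
Proof.
  intros H; destruct (Rle_dec a b) as [|n]; [assumption|].
  specialize (H ((a - b) / 2)); lra.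
Qed.

Lemma C_eq_of_close a b : (forall e, 0 < e -> Cabs (Csub a b) <= e) -> a = b.
Proof.
  intros H; assert (H0 : Csub a b = C0).
  { apply Cabs_eq0, Rle_of_le_eps; intros e He; specialize (H e He); lra. }
  replace a with (Cadd (Csub a b) b) by ring; rewrite H0; ring.
Qed.

Lemma Cconj_add a b : Cconj (Cadd a b) = Cadd (Cconj a) (Cconj b).
Proof. apply C_ext; simpl; ring. Qed.
Lemma Cconj_sub a b : Cconj (Csub a b) = Csub (Cconj a) (Cconj b).
Proof. apply C_ext; simpl; ring. Qed.
Lemma Cconj_mul a b : Cconj (Cmul a b) = Cmul (Cconj a) (Cconj b).
Proof. apply C_ext; simpl; ring. Qed.
Lemma Cconj_conj a : Cconj (Cconj a) = a.
Proof. apply C_ext; simpl; ring. Qed.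
Lemma Cconj_0 : Cconj C0 = C0.
Proof. apply C_ext; simpl; ring. Qed.
Lemma Cconj_1 : Cconj C1 = C1.
Proof. apply C_ext; simpl; ring. Qed.

Notation dec := excluded_middle_informative.
Definition eqdec {T : Type} (x y : T) : {x = y} + {x <> y} := dec (x = y).

(** * Finite sums and unordered summation *)

Section Sums.
Context {G : group}.
Implicit Types (f g : G -> R) (u w : G -> C) (l : list G).
Local Notation lsum := (Defs.lsum G).
Local Notation lsumC := (Defs.lsumC G).

Lemma lsum_cons f a l : lsum f (a :: l) = f a + lsum f l.
Proof. reflexivity. Qed.

Lemma lsumC_cons u a l : lsumC u (a :: l) = Cadd (u a) (lsumC u l).
Proof. reflexivity. Qed.

Lemma lsum_nonneg f l : (forall t, 0 <= f t) -> 0 <= lsum f l.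
Proof. intros H; induction l as [|a l IH]; simpl; [lra|specialize (H a); lra]. Qed.

Lemma lsum_le f g l : (forall t, f t <= g t) -> lsum f l <= lsum g l.
Proof. intros H; induction l as [|a l IH]; simpl; [lra|specialize (H a); lra]. Qed.

Lemma lsum_add f g l : lsum (fun t => f t + g t) l = lsum f l + lsum g l.
Proof. induction l as [|a l IH]; simpl; [lra|rewrite IH; lra]. Qed.

Lemma lsum_scal c f l : lsum (fun t => c * f t) l = c * lsum f l.
Proof. induction l as [|a l IH]; simpl; [lra|rewrite IH; lra]. Qed.

Lemma lsum_app f l1 l2 : lsum f (l1 ++ l2) = lsum f l1 + lsum f l2.
Proof. induction l1 as [|a l IH]; simpl; [lra|rewrite IH; lra]. Qed.

Lemma lsum_map f (p : G -> G) l : lsum f (map p l) = lsum (fun t => f (p t)) l.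
Proof. induction l as [|a l IH]; simpl; [lra|rewrite IH; lra]. Qed.

Lemma lsum_incl f l l' :
  (forall t, 0 <= f t) -> NoDup l -> incl l l' -> lsum f l <= lsum f l'.
Proof.
  intros Hf Hl; revert l'; induction Hl as [|a l Ha Hl IH]; intros l' Hi.
  - apply lsum_nonneg, Hf.
  - destruct (in_split a l') as [l1 [l2 ->]]; [apply Hi; left; reflexivity|].
    assert (H : incl l (l1 ++ l2)).
    { intros t Ht; assert (Ht' : In t (l1 ++ a :: l2)) by (apply Hi; right; exact Ht).
      apply in_or_app; apply in_app_or in Ht'; destruct Ht' as [|[<-|]]; auto.
      contradiction. }
    specialize (IH _ H); rewrite lsum_app in *; simpl; lra.
Qed.

Lemma lsum_indicator (P : G -> Prop) f l :
  lsum (fun t => if dec (P t) then f t else 0) l =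
  lsum f (filter (fun t => if dec (P t) then true else false) l).
Proof.
  induction l as [|a l IH]; simpl; [reflexivity|].
  destruct (dec (P a)); simpl; rewrite IH; lra.
Qed.

Lemma lsum_cauchy_schwarz f g l :
  (forall t, 0 <= f t) -> (forall t, 0 <= g t) ->
  lsum (fun t => f t * g t) l * lsum (fun t => f t * g t) l
    <= lsum (fun t => f t * f t) l * lsum (fun t => g t * g t) l.
Proof.
  intros Hf Hg; induction l as [|a l IH]; simpl; [lra|].
  assert (Hs : 0 <= lsum (fun t => f t * g t) l)
    by (apply lsum_nonneg; intros; apply Rmult_le_pos; auto).
  assert (Hp : 0 <= lsum (fun t => f t * f t) l) by (apply lsum_nonneg; intros; nra).
  assert (Hq : 0 <= lsum (fun t => g t * g t) l) by (apply lsum_nonneg; intros; nra).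
  set (S := lsum (fun t => f t * g t) l) in *.
  set (p := lsum (fun t => f t * f t) l) in *.
  set (q := lsum (fun t => g t * g t) l) in *.
  specialize (Hf a); specialize (Hg a).
  set (x := f a) in *; set (y := g a) in *.
  (* As S S <= p q, the square of 2 S x y is at most 4 (p y y) (q x x), which by the inequality of
     arithmetic and geometric means is at most the square of the right-hand side. *)
  assert (H : 2 * (S * (x * y)) <= p * (y * y) + q * (x * x)).
  { apply le_of_sqr_le.
    - apply Rplus_le_le_0_compat; apply Rmult_le_pos; nra.
    - assert (H1 : (S * S) * ((x * y) * (x * y)) <= (p * q) * ((x * y) * (x * y)))
        by (apply Rmult_le_compat_r; [nra|exact IH]).
      pose proof (Rle_0_sqr (p * (y * y) - q * (x * x))) as H2; unfold Rsqr in H2; nra. }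
  nra.
Qed.

Lemma lsumC_ext u w l : (forall t, u t = w t) -> lsumC u l = lsumC w l.
Proof. intros H; induction l as [|a l IH]; simpl; [|rewrite IH, H]; reflexivity. Qed.

Lemma lsumC_add u w l : lsumC (fun t => Cadd (u t) (w t)) l = Cadd (lsumC u l) (lsumC w l).
Proof. induction l as [|a l IH]; simpl; [|rewrite IH]; ring. Qed.

Lemma lsumC_scal c u l : lsumC (fun t => Cmul c (u t)) l = Cmul c (lsumC u l).
Proof. induction l as [|a l IH]; simpl; [|rewrite IH]; ring. Qed.

Lemma lsumC_conj u l : lsumC (fun t => Cconj (u t)) l = Cconj (lsumC u l).
Proof.
  induction l as [|a l IH]; simpl; [rewrite Cconj_0|rewrite IH, Cconj_add]; reflexivity.
Qed.

Lemma lsumC_reim u l :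
  lsumC u l = mkC (lsum (fun t => re (u t)) l) (lsum (fun t => im (u t)) l).
Proof. induction l as [|a l IH]; simpl; [|rewrite IH]; reflexivity. Qed.

Lemma Cabs_lsumC u l : Cabs (lsumC u l) <= lsum (fun t => Cabs (u t)) l.
Proof.
  induction l as [|a l IH]; simpl; [rewrite Cabs_0; lra|].
  eapply Rle_trans; [apply Cabs_triangle|lra].
Qed.

Lemma lsumC_single (s : G) (c : C) l : NoDup l ->
  lsumC (fun t => if dec (t = s) then c else C0) l = if dec (In s l) then c else C0.
Proof.
  induction l as [|a l IH]; intros Hl.
  - destruct (dec (In s [])) as [[]|]; reflexivity.
  - apply NoDup_cons_iff in Hl; destruct Hl as [Ha Hl].
    rewrite lsumC_cons, (IH Hl).
    destruct (dec (a = s)) as [<-|n]; destruct (dec (In _ l)) as [i|i];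
      destruct (dec (In _ (_ :: l))) as [j|j]; simpl in *; try tauto; ring.
Qed.

Lemma nodup_union (l1 l2 : list G) :
  exists l, NoDup l /\ incl l1 l /\ incl l2 l /\ incl l (l1 ++ l2).
Proof.
  exists (nodup eqdec (l1 ++ l2)); repeat split.
  - apply NoDup_nodup.
  - intros t Ht; apply nodup_In, in_or_app; auto.
  - intros t Ht; apply nodup_In, in_or_app; auto.
  - intros t Ht; apply nodup_In in Ht; exact Ht.
Qed.

Definition has_sumR f (a : R) : Prop :=
  forall e, 0 < e -> exists F0, NoDup F0 /\
    forall F, NoDup F -> incl F0 F -> Rabs (lsum f F - a) <= e.

(** The value is the supremum of the finite partial sums. The last two clauses keep it as least
    upper bound: [fin_tail] estimates a tail with the second of them, [split_norm] shares a norm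
    bound between two complementary sets with both. *)
Lemma has_sumR_nonneg f M :
  (forall t, 0 <= f t) -> (forall l, NoDup l -> lsum f l <= M) ->
  exists a, has_sumR f a /\ (forall N, (forall l, NoDup l -> lsum f l <= N) -> a <= N) /\
    (forall l, NoDup l -> lsum f l <= a).
Proof.
  intros Hf HM.
  destruct (completeness (fun r => exists l, NoDup l /\ r = lsum f l)) as [a [Ha1 Ha2]].
  - exists M; intros r [l [Hl ->]]; auto.
  - exists 0, []; split; [constructor|reflexivity].
  - exists a; split; [|split].
    + intros e He; apply NNPP; intros Hn.
      assert (H : a <= a - e).
      { apply Ha2; intros r [l [Hl ->]]; apply Rnot_lt_le; intros Hlt; apply Hn.
        exists l; split; [exact Hl|]; intros F HF Hi.
        pose proof (lsum_incl f l F Hf Hl Hi).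
        assert (lsum f F <= a) by (apply Ha1; exists F; auto).
        apply Rabs_le; lra. }
      lra.
    + intros N HN; apply Ha2; intros r [l [Hl ->]]; auto.
    + intros l Hl; apply Ha1; exists l; auto.
Qed.

(** Shaped for the polarization identity, where each part of an inner product is a quarter of a
    difference of squared norms. *)
Lemma has_sumR_polar f g a b :
  has_sumR f a -> has_sumR g b -> has_sumR (fun t => / 4 * (f t + (-1) * g t)) (/ 4 * (a - b)).
Proof.
  intros Hf Hg e He.
  destruct (Hf e He) as [F1 [_ H1]]; destruct (Hg e He) as [F2 [_ H2]].
  destruct (nodup_union F1 F2) as [F0 [HF0 [Hi1 [Hi2 _]]]].
  exists F0; split; [exact HF0|]; intros F HF Hi.
  specialize (H1 F HF (incl_tran Hi1 Hi)); specialize (H2 F HF (incl_tran Hi2 Hi)).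
  rewrite (lsum_scal (/ 4)), lsum_add, lsum_scal.
  apply Rabs_le; revert H1 H2; unfold Rabs; do 2 destruct Rcase_abs; lra.
Qed.

Lemma has_sumC_reim u a b :
  has_sumR (fun t => re (u t)) a -> has_sumR (fun t => im (u t)) b ->
  has_sumC G u (mkC a b).
Proof.
  intros Hf Hg e He.
  destruct (Hf (e / 2)) as [F1 [_ H1]]; [lra|].
  destruct (Hg (e / 2)) as [F2 [_ H2]]; [lra|].
  destruct (nodup_union F1 F2) as [F0 [HF0 [Hi1 [Hi2 _]]]].
  exists F0; split; [exact HF0|]; intros F HF Hi.
  specialize (H1 F HF (incl_tran Hi1 Hi)); specialize (H2 F HF (incl_tran Hi2 Hi)).
  rewrite lsumC_reim; unfold Cnorm2; simpl.
  assert (H3 : forall x d, 0 < d -> Rabs x <= d -> x * x <= d * d).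
  { intros x d Hd Hx; pose proof (Rle_abs x); pose proof (Rle_abs (- x)).
    rewrite Rabs_Ropp in *; nra. }
  apply H3 in H1; apply H3 in H2; nra.
Qed.

Lemma has_sumC_Cabs u z : has_sumC G u z <-> forall e, 0 < e -> exists F0, NoDup F0 /\
  forall F, NoDup F -> incl F0 F -> Cabs (Csub (lsumC u F) z) <= e.
Proof.
  split; intros H e He; destruct (H e He) as [F0 [H0 H1]]; exists F0; split; auto;
    intros F HF Hi; apply Cabs_le_iff; auto with real.
Qed.

Lemma has_sumC_unique u z1 z2 : has_sumC G u z1 -> has_sumC G u z2 -> z1 = z2.
Proof.
  rewrite !has_sumC_Cabs; intros H1 H2; apply C_eq_of_close; intros e He.
  destruct (H1 (e / 2)) as [F1 [_ K1]]; [lra|]; destruct (H2 (e / 2)) as [F2 [_ K2]]; [lra|].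
  destruct (nodup_union F1 F2) as [F [HF [Hi1 [Hi2 _]]]].
  specialize (K1 F HF Hi1); specialize (K2 F HF Hi2); rewrite Cabs_sub_sym in K1.
  replace (Csub z1 z2) with (Cadd (Csub z1 (lsumC u F)) (Csub (lsumC u F) z2)) by ring.
  eapply Rle_trans; [apply Cabs_triangle|lra].
Qed.

Lemma has_sumC_add u w z1 z2 :
  has_sumC G u z1 -> has_sumC G w z2 -> has_sumC G (fun t => Cadd (u t) (w t)) (Cadd z1 z2).
Proof.
  rewrite !has_sumC_Cabs; intros H1 H2 e He.
  destruct (H1 (e / 2)) as [F1 [_ K1]]; [lra|]; destruct (H2 (e / 2)) as [F2 [_ K2]]; [lra|].
  destruct (nodup_union F1 F2) as [F0 [HF0 [Hi1 [Hi2 _]]]].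
  exists F0; split; [exact HF0|]; intros F HF Hi.
  specialize (K1 F HF (incl_tran Hi1 Hi)); specialize (K2 F HF (incl_tran Hi2 Hi)).
  rewrite lsumC_add.
  replace (Csub (Cadd (lsumC u F) (lsumC w F)) (Cadd z1 z2))
    with (Cadd (Csub (lsumC u F) z1) (Csub (lsumC w F) z2)) by ring.
  eapply Rle_trans; [apply Cabs_triangle|lra].
Qed.

Lemma has_sumC_scal c u z : has_sumC G u z -> has_sumC G (fun t => Cmul c (u t)) (Cmul c z).
Proof.
  rewrite !has_sumC_Cabs; intros H e He.
  pose proof (Cabs_pos c) as Hc.
  destruct (H (e / (Cabs c + 1))) as [F0 [HF0 K]]; [apply Rdiv_lt_0_compat; lra|].
  exists F0; split; [exact HF0|]; intros F HF Hi; specialize (K F HF Hi).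
  rewrite lsumC_scal.
  replace (Csub (Cmul c (lsumC u F)) (Cmul c z)) with (Cmul c (Csub (lsumC u F) z)) by ring.
  rewrite Cabs_mul; replace e with ((Cabs c + 1) * (e / (Cabs c + 1))) by (field; lra).
  apply Rmult_le_compat; auto using Cabs_pos; lra.
Qed.

Lemma has_sumC_conj u z : has_sumC G u z -> has_sumC G (fun t => Cconj (u t)) (Cconj z).
Proof.
  rewrite !has_sumC_Cabs; intros H e He; destruct (H e He) as [F0 [HF0 K]].
  exists F0; split; [exact HF0|]; intros F HF Hi; specialize (K F HF Hi).
  rewrite lsumC_conj, <- Cconj_sub, Cabs_conj; exact K.
Qed.

Lemma has_sumC_bound u z M :
  (forall l, NoDup l -> Cabs (lsumC u l) <= M) -> has_sumC G u z -> Cabs z <= M.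
Proof.
  rewrite has_sumC_Cabs; intros HM H; apply Rle_of_le_eps; intros e He.
  destruct (H e He) as [F0 [HF0 K]]; specialize (K F0 HF0 (incl_refl _)).
  specialize (HM F0 HF0); rewrite Cabs_sub_sym in K.
  replace z with (Cadd (Csub z (lsumC u F0)) (lsumC u F0)) by ring.
  eapply Rle_trans; [apply Cabs_triangle|lra].
Qed.

Lemma has_sumC_single (s : G) (c : C) : has_sumC G (fun t => if dec (t = s) then c else C0) c.
Proof.
  rewrite has_sumC_Cabs; intros e He; exists [s]; split; [repeat constructor; intros []|].
  intros F HF Hi; rewrite lsumC_single by assumption.
  destruct (dec (In s F)) as [_|n]; [|elim n; apply Hi; left; reflexivity].
  replace (Csub c c) with C0 by ring; rewrite Cabs_0; lra.
Qed.

End Sums.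

Lemma vec_ext {G : group} (x y : vec G) : (forall t, x t = y t) -> x = y.
Proof. intros; apply functional_extensionality; assumption. Qed.

Ltac vec_ring :=
  apply vec_ext; intro; unfold Defs.vadd, Defs.vsub, Defs.vscal, Defs.vzero; ring.

(** * The norm of l2(G) *)

Section Hilbert.
Context {G : group}.
Implicit Types (x y w : vec G) (T S : op G) (l : list G).
Local Notation lsum := (Defs.lsum G).
Local Notation lsumC := (Defs.lsumC G).
Local Notation vadd := (Defs.vadd G).
Local Notation vsub := (Defs.vsub G).
Local Notation vscal := (Defs.vscal G).
Local Notation vzero := (Defs.vzero G).
Local Notation vnorm_le := (Defs.vnorm_le G).
Local Notation l2 := (Defs.l2 G).
Local Notation proj := (Defs.proj G).
Local Notation linear_l2 := (Defs.linear_l2 G).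
Local Notation op_le := (Defs.op_le G).
Local Notation inner := (Defs.inner G).
Local Notation is_adjoint := (Defs.is_adjoint G).
Local Notation strong_lim := (Defs.strong_lim G).

Definition delta (s : G) : vec G := fun t => if dec (t = s) then C1 else C0.

Lemma vnorm_le_pos x r : vnorm_le x r -> 0 <= r.
Proof. intros [H _]; exact H. Qed.

Lemma vnorm_le_dom x y c r :
  0 <= c -> (forall t, Cabs (y t) <= c * Cabs (x t)) -> vnorm_le x r -> vnorm_le y (c * r).
Proof.
  intros Hc H [Hr Hx]; split; [apply Rmult_le_pos; assumption|]; intros l Hl.
  specialize (Hx l Hl).
  apply Rle_trans with (c * c * lsum (fun t => Cnorm2 (x t)) l); [|nra].
  rewrite <- lsum_scal; apply lsum_le; intros t.
  rewrite <- !Cabs_sqr; specialize (H t); pose proof (Cabs_pos (y t)); pose proof (Cabs_pos (x t)).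
  replace (c * c * (Cabs (x t) * Cabs (x t))) with ((c * Cabs (x t)) * (c * Cabs (x t))) by ring.
  apply Rmult_le_compat; assumption.
Qed.

Lemma vnorm_le_dom1 x y r :
  (forall t, Cabs (y t) <= Cabs (x t)) -> vnorm_le x r -> vnorm_le y r.
Proof.
  intros H Hx; rewrite <- (Rmult_1_l r); apply vnorm_le_dom with x; [lra| |exact Hx].
  intros t; specialize (H t); lra.
Qed.

Lemma vnorm_le_weaken x r s : r <= s -> vnorm_le x r -> vnorm_le x s.
Proof. intros H [H0 H1]; split; [lra|]; intros l Hl; specialize (H1 l Hl); nra. Qed.

Lemma vnorm_le_zero r : 0 <= r -> vnorm_le vzero r.
Proof.
  intros Hr; split; [exact Hr|]; intros l _.
  replace (lsum (fun t => Cnorm2 (vzero t)) l) with 0; [nra|].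
  induction l as [|a l IH]; simpl; [reflexivity|]; rewrite <- IH; unfold Cnorm2; simpl; ring.
Qed.

Lemma vnorm_le_scal c x r : vnorm_le x r -> vnorm_le (vscal c x) (Cabs c * r).
Proof.
  apply vnorm_le_dom; [apply Cabs_pos|]; intros t; unfold Defs.vscal; rewrite Cabs_mul; lra.
Qed.

(** Minkowski's inequality, from Cauchy-Schwarz on each finite list. *)
Lemma vnorm_le_add x y r s : vnorm_le x r -> vnorm_le y s -> vnorm_le (vadd x y) (r + s).
Proof.
  intros [Hr Hx] [Hs Hy]; split; [lra|]; intros l Hl; specialize (Hx l Hl); specialize (Hy l Hl).
  set (f := fun t => Cabs (x t)); set (g := fun t => Cabs (y t)).
  assert (Ef : lsum (fun t => Cnorm2 (x t)) l = lsum (fun t => f t * f t) l).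
  { apply Rle_antisym; apply lsum_le; intros; unfold f; rewrite Cabs_sqr; lra. }
  assert (Eg : lsum (fun t => Cnorm2 (y t)) l = lsum (fun t => g t * g t) l).
  { apply Rle_antisym; apply lsum_le; intros; unfold g; rewrite Cabs_sqr; lra. }
  rewrite Ef in Hx; rewrite Eg in Hy.
  assert (Hf : forall t, 0 <= f t) by (intros; apply Cabs_pos).
  assert (Hg : forall t, 0 <= g t) by (intros; apply Cabs_pos).
  pose proof (lsum_cauchy_schwarz f g l Hf Hg) as HCS.
  assert (Hp : 0 <= lsum (fun t => f t * f t) l) by (apply lsum_nonneg; intros; nra).
  assert (Hq : 0 <= lsum (fun t => g t * g t) l) by (apply lsum_nonneg; intros; nra).
  assert (Hm : lsum (fun t => f t * g t) l <= r * s).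
  { apply le_of_sqr_le; [nra|]; eapply Rle_trans; [exact HCS|].
    replace (r * s * (r * s)) with ((r * r) * (s * s)) by ring.
    apply Rmult_le_compat; assumption. }
  apply Rle_trans with (lsum (fun t => f t * f t + (2 * (f t * g t) + g t * g t)) l).
  - apply lsum_le; intros t; rewrite <- Cabs_sqr; unfold f, g.
    pose proof (Cabs_triangle (x t) (y t)); pose proof (Cabs_pos (vadd x y t)).
    unfold Defs.vadd in *; nra.
  - rewrite !lsum_add, lsum_scal; nra.
Qed.

Lemma vsub_eq x y : vsub x y = vadd x (vscal (Copp C1) y).
Proof. vec_ring. Qed.

Lemma vnorm_le_sub x y r s : vnorm_le x r -> vnorm_le y s -> vnorm_le (vsub x y) (r + s).
Proof.
  intros Hx Hy; rewrite vsub_eq; apply vnorm_le_add; [exact Hx|].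
  replace s with (Cabs (Copp C1) * s) by (rewrite Cabs_opp, Cabs_1; ring).
  apply vnorm_le_scal, Hy.
Qed.

Lemma vnorm_le_sub_sym x y r : vnorm_le (vsub x y) r -> vnorm_le (vsub y x) r.
Proof. apply vnorm_le_dom1; intros t; unfold Defs.vsub; rewrite Cabs_sub_sym; lra. Qed.

Lemma vnorm_le_sub_trans x y z r s :
  vnorm_le (vsub x y) r -> vnorm_le (vsub y z) s -> vnorm_le (vsub x z) (r + s).
Proof.
  intros H1 H2; replace (vsub x z) with (vadd (vsub x y) (vsub y z)) by vec_ring.
  apply vnorm_le_add; assumption.
Qed.

Lemma vnorm_le_self_sub x r : 0 <= r -> vnorm_le (vsub x x) r.
Proof. intros H; replace (vsub x x) with vzero by vec_ring; apply vnorm_le_zero, H. Qed.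

Lemma vnorm_le_coord x r t : vnorm_le x r -> Cabs (x t) <= r.
Proof.
  intros [Hr H]; apply Cabs_le_iff; [exact Hr|].
  specialize (H [t] ltac:(repeat constructor; intros [])); simpl in H; lra.
Qed.

Lemma vnorm_le_eps x r : 0 <= r -> (forall e, 0 < e -> vnorm_le x (r + e)) -> vnorm_le x r.
Proof.
  intros Hr H; split; [exact Hr|]; intros l Hl; apply Rle_of_le_eps; intros e He.
  destruct (Rle_dec (lsum (fun t => Cnorm2 (x t)) l) (r * r)); [lra|].
  (* Since d <= 1, the square of r + d is at most r r + d (2 r + 1), hence at most r r + e. *)
  set (d := Rmin 1 (e / (2 * r + 1))).
  assert (Hd0 : 0 < e / (2 * r + 1)) by (apply Rdiv_lt_0_compat; lra).
  assert (Hd : 0 < d) by (unfold d; apply Rmin_glb_lt; lra).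
  assert (Hd1 : d <= 1) by apply Rmin_l.
  assert (Hd2 : d * (2 * r + 1) <= e).
  { replace e with (e / (2 * r + 1) * (2 * r + 1)) at 1 by (field; lra).
    apply Rmult_le_compat_r; [lra|apply Rmin_r]. }
  destruct (H d Hd) as [_ H1]; specialize (H1 l Hl); nra.
Qed.

Lemma vnorm_le_reindex (p : G -> G) x r :
  (forall s t, p s = p t -> s = t) -> vnorm_le x r -> vnorm_le (fun t => x (p t)) r.
Proof.
  intros Hp [Hr H]; split; [exact Hr|]; intros l Hl.
  rewrite <- (lsum_map (fun t => Cnorm2 (x t)) p l); apply H.
  apply Injective_map_NoDup; auto.
Qed.

Lemma vnorm_le_proj (P : G -> Prop) x r : vnorm_le x r -> vnorm_le (proj P x) r.
Proof.
  apply vnorm_le_dom1; intros t; unfold Defs.proj; destruct (dec (P t)); [lra|].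
  rewrite Cabs_0; apply Cabs_pos.
Qed.

Lemma vnorm_le_delta s : vnorm_le (delta s) 1.
Proof.
  split; [lra|]; intros l Hl; unfold delta.
  pose proof (lsumC_single s C1 l Hl) as H; rewrite lsumC_reim in H.
  replace (lsum (fun t => Cnorm2 (if dec (t = s) then C1 else C0)) l)
    with (re (if dec (In s l) then C1 else C0)).
  - destruct (dec (In s l)); simpl; lra.
  - rewrite <- H; simpl; clear.
    induction l as [|a l IH]; simpl; [reflexivity|]; rewrite IH; f_equal.
    destruct (dec (a = s)); unfold Cnorm2; simpl; ring.
Qed.

Lemma l2_delta s : l2 (delta s).
Proof. exists 1; apply vnorm_le_delta. Qed.

Lemma l2_add x y : l2 x -> l2 y -> l2 (vadd x y).
Proof. intros [r H] [s K]; exists (r + s); apply vnorm_le_add; assumption. Qed.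

Lemma l2_sub x y : l2 x -> l2 y -> l2 (vsub x y).
Proof. intros [r H] [s K]; exists (r + s); apply vnorm_le_sub; assumption. Qed.

Lemma l2_scal c x : l2 x -> l2 (vscal c x).
Proof. intros [r H]; eexists; apply vnorm_le_scal, H. Qed.

Lemma l2_proj P x : l2 x -> l2 (proj P x).
Proof. intros [r H]; exists r; apply vnorm_le_proj, H. Qed.

Lemma l2_zero : l2 vzero.
Proof. exists 0; apply vnorm_le_zero; lra. Qed.

(** * Finitely supported vectors *)

(** A sum of basis vectors rather than a cut-off, so that linearity applies term by term along l.
    Repetitions in l are counted, which is why [fin_eq] asks for [NoDup]. *)
Definition fin l x : vec G :=
  fold_right (fun t acc => vadd (vscal (x t) (delta t)) acc) vzero l.

Lemma l2_fin l x : l2 (fin l x).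
Proof.
  induction l as [|a l IH]; [apply l2_zero|]; simpl.
  apply l2_add; [apply l2_scal, l2_delta|exact IH].
Qed.

Lemma fin_eq l x : NoDup l -> fin l x = proj (fun t => In t l) x.
Proof.
  induction l as [|a l IH]; intros Hl; apply vec_ext; intros t.
  - unfold Defs.proj; destruct (dec (In t [])) as [[]|]; reflexivity.
  - apply NoDup_cons_iff in Hl; destruct Hl as [Ha Hl].
    simpl; unfold Defs.vadd, Defs.vscal; rewrite (IH Hl); unfold Defs.proj, delta.
    destruct (dec (t = a)) as [->|n]; destruct (dec (In _ l)) as [i|i];
      destruct (dec (a = _ \/ _)) as [j|j] || destruct (dec (a = a \/ _)) as [j|j];
      try tauto; try ring.
    all: destruct j as [->|]; tauto.
Qed.

Lemma vnorm_le_fin_abs l x : vnorm_le (fin l x) (lsum (fun t => Cabs (x t)) l).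
Proof.
  induction l as [|a l IH]; simpl; [apply vnorm_le_zero; lra|].
  apply vnorm_le_add; [|exact IH].
  rewrite <- (Rmult_1_r (Cabs (x a))); apply vnorm_le_scal, vnorm_le_delta.
Qed.

Lemma vnorm_le_fin l x : NoDup l -> vnorm_le (fin l x) (sqrt (lsum (fun t => Cnorm2 (x t)) l)).
Proof.
  intros Hl; split; [apply sqrt_pos|]; intros l' Hl'.
  rewrite sqrt_sqrt by (apply lsum_nonneg; intros; apply Cnorm2_pos).
  rewrite (fin_eq l x Hl).
  apply Rle_trans with (lsum (fun t => if dec (In t l) then Cnorm2 (x t) else 0) l').
  - apply lsum_le; intros t; unfold Defs.proj; destruct (dec (In t l)); [lra|].
    unfold Cnorm2; simpl; lra.
  - rewrite lsum_indicator; apply lsum_incl; [intros; apply Cnorm2_pos|apply NoDup_filter, Hl'|].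
    intros t Ht; apply filter_In in Ht; destruct Ht as [_ Ht].
    destruct (dec (In t l)); [assumption|discriminate].
Qed.

Lemma fin_tail x e : l2 x -> 0 < e -> exists l, NoDup l /\ vnorm_le (vsub x (fin l x)) e.
Proof.
  intros [r [Hr Hx]] He.
  destruct (has_sumR_nonneg (fun t => Cnorm2 (x t)) (r * r)) as [a [Ha [_ Hb]]];
    [intros; apply Cnorm2_pos|exact Hx|].
  destruct (Ha (e * e)) as [F [HF K]]; [nra|].
  specialize (K F HF (incl_refl _)); exists F; split; [exact HF|].
  split; [lra|]; intros l Hl.
  rewrite (fin_eq F x HF).
  set (l' := filter (fun t => if dec (~ In t F) then true else false) l).
  apply Rle_trans with (lsum (fun t => if dec (~ In t F) then Cnorm2 (x t) else 0) l).
  - apply lsum_le; intros t; unfold Defs.vsub, Defs.proj.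
    destruct (dec (In t F)) as [i|i]; destruct (dec (~ In t F)) as [j|j]; try tauto.
    + unfold Cnorm2; simpl; nra.
    + replace (Csub (x t) C0) with (x t) by ring; lra.
  - rewrite lsum_indicator; fold l'.
    (* F carries the total mass up to e e, and l' is disjoint from F, so the mass on l' is at most e
       e. *)
    assert (Hn : NoDup (l' ++ F)).
    { apply NoDup_app; [apply NoDup_filter, Hl|exact HF|].
      intros t Ht; apply filter_In in Ht; destruct Ht as [_ Ht].
      destruct (dec (~ In t F)); [assumption|discriminate]. }
    specialize (Hb _ Hn); rewrite lsum_app in Hb.
    revert K; unfold Rabs; destruct Rcase_abs; lra.
Qed.

Lemma eventually_forall_list {I : Type} (l : list I) (P : nat -> I -> Prop) :
  (forall i, In i l -> exists N, forall n, (N <= n)%nat -> P n i) ->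
  exists N, forall n, (N <= n)%nat -> forall i, In i l -> P n i.
Proof.
  induction l as [|a l IH]; intros H; [exists 0%nat; intros n _ i []|].
  destruct IH as [N1 H1]; [intros; apply H; right; assumption|].
  destruct (H a) as [N2 H2]; [left; reflexivity|].
  exists (Nat.max N1 N2); intros n Hn i [<-|Hi]; [apply H2; lia|apply H1; [lia|exact Hi]].
Qed.

(** Lower semicontinuity of the norm under coordinatewise convergence: the norm is a supremum over
    finite sets, and on a finite set coordinatewise convergence is norm convergence. *)
Lemma vnorm_le_lim (u : nat -> vec G) x r :
  (forall t e, 0 < e -> exists N, forall n, (N <= n)%nat -> Cabs (Csub (u n t) (x t)) <= e) ->
  (exists N, forall n, (N <= n)%nat -> vnorm_le (u n) r) -> vnorm_le x r.
Proof.
  intros Hlim [N0 Hu].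
  assert (Hr : 0 <= r) by exact (vnorm_le_pos _ _ (Hu N0 (le_n _))).
  assert (Hfin : forall l, NoDup l -> vnorm_le (fin l x) r).
  { intros l Hl; apply vnorm_le_eps; [exact Hr|]; intros e He.
    (* The error e is shared among the coordinates in l; the added 1 covers the empty list. *)
    set (d := e / (1 + INR (length l))).
    pose proof (pos_INR (length l)) as Hlen.
    assert (Hd : 0 < d) by (apply Rdiv_lt_0_compat; lra).
    destruct (eventually_forall_list l (fun n t => Cabs (Csub (u n t) (x t)) <= d)) as [N HN];
      [intros; apply Hlim, Hd|].
    set (n := Nat.max N0 N).
    specialize (HN n ltac:(unfold n; lia)); specialize (Hu n ltac:(unfold n; lia)).
    replace (fin l x) with (vsub (fin l (u n)) (fin l (vsub (u n) x)))
      by (rewrite !fin_eq by exact Hl; apply vec_ext; intros t;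
          unfold Defs.vsub, Defs.proj; destruct (dec (In t l)); ring).
    apply vnorm_le_sub; [rewrite fin_eq by exact Hl; apply vnorm_le_proj, Hu|].
    eapply vnorm_le_weaken; [|apply vnorm_le_fin_abs].
    apply Rle_trans with (INR (length l) * d).
    - clear -HN; clearbody d; induction l as [|a l IH]; [simpl; lra|].
      rewrite lsum_cons; replace (INR (length (a :: l))) with (INR (length l) + 1)
        by (symmetry; apply S_INR).
      assert (H1 : Cabs (vsub (u n) x a) <= d) by (apply HN; left; reflexivity).
      assert (H2 := IH (fun i Hi => HN i (or_intror Hi))); lra.
    - replace e with ((1 + INR (length l)) * d) by (unfold d; field; lra); nra. }
  split; [exact Hr|]; intros l Hl; destruct (Hfin l Hl) as [_ H]; specialize (H l Hl).
  eapply Rle_trans; [|exact H]; rewrite (fin_eq l x Hl).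
  clear; assert (H : forall k, incl k l ->
    lsum (fun t => Cnorm2 (x t)) k <= lsum (fun t => Cnorm2 (proj (fun s => In s l) x t)) k).
  { induction k as [|a k IH]; intros Hi; simpl; [lra|].
    assert (Ha : In a l) by (apply Hi; left; reflexivity).
    specialize (IH (fun t Ht => Hi t (or_intror Ht))).
    unfold Defs.proj in *; destruct (dec (In a l)); [lra|contradiction]. }
  apply H, incl_refl.
Qed.

(** * Bounded operators *)

Definition bounded_by T (M : R) : Prop := linear_l2 T /\ op_le T M.

Lemma bounded_iff T : bounded G T <-> exists M, bounded_by T M.
Proof. unfold bounded, bounded_by; split; [intros [H [M K]]|intros [M [H K]]]; eauto. Qed.

Lemma bounded_by_bounded T M : bounded_by T M -> bounded G T.
Proof. intros H; apply bounded_iff; exists M; exact H. Qed.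

Lemma bounded_by_vnorm T M x r : bounded_by T M -> vnorm_le x r -> vnorm_le (T x) (M * r).
Proof. intros [_ [_ H]]; apply H. Qed.

Lemma op_le_l2 T M x : op_le T M -> l2 x -> l2 (T x).
Proof. intros [_ H] [r Hx]; exists (M * r); apply H, Hx. Qed.

Lemma bounded_l2 T x : bounded G T -> l2 x -> l2 (T x).
Proof. intros [_ [M H]]; apply op_le_l2 with M, H. Qed.

Lemma linear_add T x y : linear_l2 T -> l2 x -> l2 y -> T (vadd x y) = vadd (T x) (T y).
Proof. intros [H _] Hx Hy; apply vec_ext, H; assumption. Qed.

Lemma linear_scal T c x : linear_l2 T -> l2 x -> T (vscal c x) = vscal c (T x).
Proof. intros [_ H] Hx; apply vec_ext, H; assumption. Qed.

Lemma linear_sub T x y : linear_l2 T -> l2 x -> l2 y -> T (vsub x y) = vsub (T x) (T y).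
Proof.
  intros HT Hx Hy; rewrite !vsub_eq, linear_add, linear_scal; auto using l2_scal.
Qed.

Lemma linear_zero T : linear_l2 T -> T vzero = vzero.
Proof.
  intros HT; replace vzero with (vscal C0 vzero) at 1 by vec_ring.
  rewrite linear_scal; auto using l2_zero; vec_ring.
Qed.

Lemma op_le_weaken T M N : M <= N -> op_le T M -> op_le T N.
Proof.
  intros H [H0 H1]; split; [lra|]; intros x s Hx; eapply vnorm_le_weaken; [|apply H1, Hx].
  pose proof (vnorm_le_pos _ _ Hx); nra.
Qed.

Lemma bounded_by_weaken T M N : M <= N -> bounded_by T M -> bounded_by T N.
Proof. intros H [H0 H1]; split; [exact H0|apply op_le_weaken with M; assumption]. Qed.

Lemma bounded_by_add T S M N : bounded_by T M -> bounded_by S N -> bounded_by (opadd G T S) (M + N).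
Proof.
  intros [[HT1 HT2] [HM HT]] [[HS1 HS2] [HN HS]]; split; split.
  - intros x y Hx Hy t.
    change (Cadd (T (vadd x y) t) (S (vadd x y) t) =
      Cadd (Cadd (T x t) (S x t)) (Cadd (T y t) (S y t))).
    rewrite HT1, HS1 by assumption; unfold Defs.vadd; ring.
  - intros c x Hx t.
    change (Cadd (T (vscal c x) t) (S (vscal c x) t) = Cmul c (Cadd (T x t) (S x t))).
    rewrite HT2, HS2 by assumption; unfold Defs.vscal; ring.
  - lra.
  - intros x s Hx; rewrite Rmult_plus_distr_r; apply vnorm_le_add; auto.
Qed.

Lemma bounded_by_scal c T M : bounded_by T M -> bounded_by (opscal G c T) (Cabs c * M).
Proof.
  intros [[HT1 HT2] [HM HT]]; split; split.
  - intros x y Hx Hy t.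
    change (Cmul c (T (vadd x y) t) = Cadd (Cmul c (T x t)) (Cmul c (T y t))).
    rewrite HT1 by assumption; unfold Defs.vadd; ring.
  - intros d x Hx t.
    change (Cmul c (T (vscal d x) t) = Cmul d (Cmul c (T x t))).
    rewrite HT2 by assumption; unfold Defs.vscal; ring.
  - apply Rmult_le_pos; [apply Cabs_pos|exact HM].
  - intros x s Hx; rewrite Rmult_assoc; apply vnorm_le_scal; auto.
Qed.

Lemma opsub_eq T S : opsub G T S = opadd G T (opscal G (Copp C1) S).
Proof. apply functional_extensionality; intros x; apply vsub_eq. Qed.

Lemma bounded_by_sub T S M N : bounded_by T M -> bounded_by S N -> bounded_by (opsub G T S) (M + N).
Proof.
  intros HT HS; rewrite opsub_eq; apply bounded_by_add; [exact HT|].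
  replace N with (Cabs (Copp C1) * N) by (rewrite Cabs_opp, Cabs_1; ring).
  apply bounded_by_scal, HS.
Qed.

Lemma bounded_by_comp T S M N :
  bounded_by T M -> bounded_by S N -> bounded_by (opcomp G T S) (M * N).
Proof.
  intros [LT [HM HT]] [LS [HN HS]]; split; split.
  - intros x y Hx Hy t; unfold opcomp.
    rewrite (linear_add S), (linear_add T); eauto using op_le_l2; eapply op_le_l2; eauto; split; eauto.
  - intros c x Hx t; unfold opcomp.
    rewrite (linear_scal S), (linear_scal T); eauto; eapply op_le_l2; eauto; split; eauto.
  - apply Rmult_le_pos; assumption.
  - intros x s Hx; rewrite Rmult_assoc; apply HT, HS, Hx.
Qed.

Lemma bounded_by_id : bounded_by (opid G) 1.
Proof.
  split; split; try reflexivity; [lra|]; intros x s Hx; rewrite Rmult_1_l; exact Hx.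
Qed.

Lemma bounded_by_zero : bounded_by (opzero G) 0.
Proof.
  split; split; try (intros; unfold opzero, Defs.vadd, Defs.vscal, Defs.vzero; ring); [lra|].
  intros x s Hx; rewrite Rmult_0_l; apply vnorm_le_zero; lra.
Qed.

Lemma bounded_by_proj P : bounded_by (proj P) 1.
Proof.
  split; split.
  - intros x y _ _ t; unfold Defs.proj, Defs.vadd; destruct (dec (P t)); ring.
  - intros c x _ t; unfold Defs.proj, Defs.vscal; destruct (dec (P t)); ring.
  - lra.
  - intros x s Hx; rewrite Rmult_1_l; apply vnorm_le_proj, Hx.
Qed.

Lemma gmul_cancel_r (a b r : G) : gmul a r = gmul b r -> a = b.
Proof.
  intros H; rewrite <- (gmul1r _ a), <- (gmul1r _ b), <- (gmulVr _ r), !gmulA, H; reflexivity.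
Qed.

Lemma gmul_cancel_l (a b r : G) : gmul r a = gmul r b -> a = b.
Proof.
  intros H; rewrite <- (gmul1l _ a), <- (gmul1l _ b), <- (gmulVl _ r), <- !gmulA, H; reflexivity.
Qed.

Lemma bounded_by_Rop r : bounded_by (Rop G r) 1.
Proof.
  split; split; try reflexivity; [lra|]; intros x s Hx; rewrite Rmult_1_l.
  apply (vnorm_le_reindex (fun t => gmul t r)); [|exact Hx].
  intros a b; apply gmul_cancel_r.
Qed.

Lemma bounded_by_RopInv r : bounded_by (RopInv G r) 1.
Proof. apply bounded_by_Rop. Qed.

Lemma bounded_by_Lop r : bounded_by (Lop G r) 1.
Proof.
  split; split; try reflexivity; [lra|]; intros x s Hx; rewrite Rmult_1_l.
  apply (vnorm_le_reindex (fun t => gmul (ginv r) t)); [|exact Hx].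
  intros a b; apply gmul_cancel_l.
Qed.

Lemma bounded_by_mulop (a : G -> C) M :
  0 <= M -> (forall t, Cabs (a t) <= M) -> bounded_by (mulop G a) M.
Proof.
  intros HM Ha; split; split.
  - intros x y _ _ t; unfold mulop, Defs.vadd; ring.
  - intros c x _ t; unfold mulop, Defs.vscal; ring.
  - exact HM.
  - intros x s; apply vnorm_le_dom; [exact HM|]; intros t; unfold mulop; rewrite Cabs_mul.
    apply Rmult_le_compat_r; [apply Cabs_pos|apply Ha].
Qed.

Lemma bounded_by_op_eq T S M : op_eq G T S -> bounded_by T M -> bounded_by S M.
Proof.
  intros E [L [HM HT]].
  assert (E' : forall x, l2 x -> S x = T x) by (intros; apply vec_ext; intros; symmetry; apply E; auto).
  split; split.
  - intros x y Hx Hy t; rewrite !E' by auto using l2_add; apply L; assumption.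
  - intros c x Hx t; rewrite !E' by auto using l2_scal; apply L; assumption.
  - exact HM.
  - intros x s Hx; rewrite E' by (exists s; exact Hx); apply HT, Hx.
Qed.

(** * Strong convergence *)

Lemma strong_lim_coord (T : nat -> op G) S x t e :
  strong_lim T S -> l2 x -> 0 < e ->
  exists N, forall n, (N <= n)%nat -> Cabs (Csub (T n x t) (S x t)) <= e.
Proof.
  intros H Hx He; destruct (H x Hx e He) as [N HN]; exists N; intros n Hn.
  apply (vnorm_le_coord (vsub (T n x) (S x))), HN, Hn.
Qed.

Lemma strong_lim_unique (T : nat -> op G) S1 S2 :
  strong_lim T S1 -> strong_lim T S2 -> op_eq G S1 S2.
Proof.
  intros H1 H2 x Hx t; apply C_eq_of_close; intros e He.
  destruct (strong_lim_coord T S1 x t (e / 2) H1 Hx) as [N1 K1]; [lra|].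
  destruct (strong_lim_coord T S2 x t (e / 2) H2 Hx) as [N2 K2]; [lra|].
  specialize (K1 (Nat.max N1 N2) ltac:(lia)); specialize (K2 (Nat.max N1 N2) ltac:(lia)).
  rewrite Cabs_sub_sym in K1.
  set (c := T (Nat.max N1 N2) x t) in *.
  replace (Csub (S1 x t) (S2 x t)) with (Cadd (Csub (S1 x t) c) (Csub c (S2 x t))) by ring.
  eapply Rle_trans; [apply Cabs_triangle|lra].
Qed.

Lemma strong_lim_const T : strong_lim (fun _ => T) T.
Proof. intros x _ e He; exists 0%nat; intros n _; apply vnorm_le_self_sub; lra. Qed.

Lemma strong_lim_sub (T T' : nat -> op G) S S' :
  strong_lim T S -> strong_lim T' S' -> strong_lim (fun n => opsub G (T n) (T' n)) (opsub G S S').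
Proof.
  intros H H' x Hx e He.
  destruct (H x Hx (e / 2)) as [N HN]; [lra|]; destruct (H' x Hx (e / 2)) as [N' HN']; [lra|].
  exists (Nat.max N N'); intros n Hn; unfold opsub.
  replace (vsub (vsub (T n x) (T' n x)) (vsub (S x) (S' x)))
    with (vsub (vsub (T n x) (S x)) (vsub (T' n x) (S' x))) by vec_ring.
  replace e with (e / 2 + e / 2) by field.
  apply vnorm_le_sub; [apply HN|apply HN']; lia.
Qed.

Lemma strong_lim_op_eq (T : nat -> op G) S S' :
  op_eq G S S' -> strong_lim T S -> strong_lim T S'.
Proof.
  intros E H x Hx; replace (S' x) with (S x); [exact (H x Hx)|].
  apply vec_ext, E, Hx.
Qed.

Lemma strong_lim_subseq (T : nat -> op G) S (phi : nat -> nat) :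
  (forall j, (j <= phi j)%nat) -> strong_lim T S -> strong_lim (fun j => T (phi j)) S.
Proof.
  intros Hp H x Hx e He; destruct (H x Hx e He) as [N HN]; exists N; intros n Hn.
  apply HN; specialize (Hp n); lia.
Qed.

(* Uniform boundedness reduces strong convergence to convergence on the basis vectors. *)
Lemma strong_lim_transfer (T T' : nat -> op G) S M :
  (forall n, bounded_by (T n) M) -> (forall n, bounded_by (T' n) M) ->
  (forall s e, 0 < e -> exists N, forall n, (N <= n)%nat ->
     vnorm_le (vsub (T n (delta s)) (T' n (delta s))) e) ->
  strong_lim T' S -> strong_lim T S.
Proof.
  intros HT HT' Hd HS.
  set (D := fun n => opsub G (T n) (T' n)).
  assert (HD : forall n, bounded_by (D n) (M + M)) by (intros; apply bounded_by_sub; auto).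
  assert (HM : 0 <= M) by (destruct (HT 0%nat) as [_ [HM _]]; exact HM).
  assert (Hfin : forall x l e, 0 < e -> exists N, forall n, (N <= n)%nat ->
            vnorm_le (D n (fin l x)) e).
  { intros x l; induction l as [|a l IH]; intros e He.
    - exists 0%nat; intros n _; simpl; rewrite linear_zero by apply (HD n).
      apply vnorm_le_zero; lra.
    - pose proof (Cabs_pos (x a)).
      destruct (IH (e / 2)) as [N1 H1]; [lra|].
      destruct (Hd a (e / 2 / (Cabs (x a) + 1))) as [N2 H2];
        [apply Rdiv_lt_0_compat; lra|].
      exists (Nat.max N1 N2); intros n Hn; simpl.
      rewrite linear_add, linear_scal by (try apply (HD n); auto using l2_scal, l2_delta, l2_fin).
      replace e with (e / 2 + e / 2) by field; apply vnorm_le_add; [|apply H1; lia].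
      eapply vnorm_le_weaken; [|apply vnorm_le_scal, H2; lia].
      replace (e / 2) with ((Cabs (x a) + 1) * (e / 2 / (Cabs (x a) + 1))) at 2 by (field; lra).
      apply Rmult_le_compat_r; [|lra]; left; apply Rdiv_lt_0_compat; lra. }
  intros x Hx e He.
  destruct (fin_tail x (e / 3 / (M + M + 1)) Hx) as [l [_ Hl]]; [apply Rdiv_lt_0_compat; lra|].
  destruct (Hfin x l (e / 3)) as [N1 H1]; [lra|].
  destruct (HS x Hx (e / 3)) as [N2 H2]; [lra|].
  exists (Nat.max N1 N2); intros n Hn.
  replace (vsub (T n x) (S x)) with (vadd (D n x) (vsub (T' n x) (S x)))
    by (unfold D, opsub; vec_ring).
  replace e with (2 * (e / 3) + e / 3) by field; apply vnorm_le_add; [|apply H2; lia].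
  replace x with (vadd (vsub x (fin l x)) (fin l x)) by vec_ring.
  rewrite linear_add by (try apply (HD n); auto using l2_sub, l2_fin).
  replace (2 * (e / 3)) with (e / 3 + e / 3) by field; apply vnorm_le_add; [|apply H1; lia].
  eapply vnorm_le_weaken; [|eapply bounded_by_vnorm; [apply HD|exact Hl]].
  replace (e / 3) with ((M + M + 1) * (e / 3 / (M + M + 1))) at 2 by (field; lra).
  apply Rmult_le_compat_r; [|lra]; left; apply Rdiv_lt_0_compat; lra.
Qed.

Lemma strong_lim_delta (T : nat -> op G) S M :
  (forall n, bounded_by (T n) M) -> bounded_by S M ->
  (forall s e, 0 < e -> exists N, forall n, (N <= n)%nat ->
     vnorm_le (vsub (T n (delta s)) (S (delta s))) e) ->
  strong_lim T S.
Proof.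
  intros HT HS H; apply strong_lim_transfer with (fun _ => S) M; auto using strong_lim_const.
Qed.

(** Linearity passes to the limit coordinatewise, the bound by [vnorm_le_lim]. This turns the limits
    A and Op(A), given as bare maps on vectors, into bounded operators. *)
Lemma strong_lim_bounded_by (T : nat -> op G) S M :
  (forall n, bounded_by (T n) M) -> strong_lim T S -> bounded_by S M.
Proof.
  intros HT HS; assert (HM : 0 <= M) by (destruct (HT 0%nat) as [_ [HM _]]; exact HM).
  split; split.
  - intros x y Hx Hy t; apply C_eq_of_close; intros e He.
    destruct (strong_lim_coord T S (vadd x y) t (e / 3) HS) as [N1 H1]; auto using l2_add; [lra|].
    destruct (strong_lim_coord T S x t (e / 3) HS Hx) as [N2 H2]; [lra|].
    destruct (strong_lim_coord T S y t (e / 3) HS Hy) as [N3 H3]; [lra|].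
    set (n := Nat.max N1 (Nat.max N2 N3)).
    specialize (H1 n ltac:(lia)); specialize (H2 n ltac:(lia)); specialize (H3 n ltac:(lia)).
    rewrite (linear_add (T n)) in H1 by (auto; apply (HT n)).
    unfold Defs.vadd in *; rewrite Cabs_sub_sym in H1.
    replace (Csub (S (fun t0 => Cadd (x t0) (y t0)) t) (Cadd (S x t) (S y t))) with
      (Cadd (Csub (S (fun t0 => Cadd (x t0) (y t0)) t) (Cadd (T n x t) (T n y t)))
        (Cadd (Csub (T n x t) (S x t)) (Csub (T n y t) (S y t)))) by ring.
    eapply Rle_trans; [apply Cabs_triangle|].
    pose proof (Cabs_triangle (Csub (T n x t) (S x t)) (Csub (T n y t) (S y t))); lra.
  - intros c x Hx t; apply C_eq_of_close; intros e He.
    pose proof (Cabs_pos c).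
    destruct (strong_lim_coord T S (vscal c x) t (e / 2) HS) as [N1 H1]; auto using l2_scal; [lra|].
    destruct (strong_lim_coord T S x t (e / 2 / (Cabs c + 1)) HS Hx) as [N2 H2];
      [apply Rdiv_lt_0_compat; lra|].
    set (n := Nat.max N1 N2).
    specialize (H1 n ltac:(lia)); specialize (H2 n ltac:(lia)).
    rewrite (linear_scal (T n)) in H1 by (auto; apply (HT n)).
    rewrite Cabs_sub_sym in H1.
    replace (Csub (S (vscal c x) t) (vscal c (S x) t)) with
      (Cadd (Csub (S (vscal c x) t) (vscal c (T n x) t)) (Cmul c (Csub (T n x t) (S x t))))
      by (unfold Defs.vscal; ring).
    eapply Rle_trans; [apply Cabs_triangle|]; rewrite Cabs_mul.
    assert (Cabs c * Cabs (Csub (T n x t) (S x t)) <= (Cabs c + 1) * (e / 2 / (Cabs c + 1))).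
    { apply Rmult_le_compat; auto using Cabs_pos; lra. }
    replace ((Cabs c + 1) * (e / 2 / (Cabs c + 1))) with (e / 2) in * by (field; lra); lra.
  - exact HM.
  - intros x s Hx; apply vnorm_le_lim with (fun n => T n x).
    + intros t e He; apply strong_lim_coord; auto; exists s; exact Hx.
    + exists 0%nat; intros n _; apply bounded_by_vnorm; auto.
Qed.

(** * Inner products and adjoints *)

Lemma inner_unique x y z1 z2 : inner x y z1 -> inner x y z2 -> z1 = z2.
Proof. apply has_sumC_unique. Qed.

(* Polarization: both parts of <x, y> are differences of squared norms. *)
Lemma inner_ex x y : l2 x -> l2 y -> exists z, inner x y z.
Proof.
  intros Hx Hy.
  assert (Hn : forall w, l2 w -> exists a, has_sumR (fun t => Cnorm2 (w t)) a).
  { intros w [r [_ Hw]].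
    destruct (has_sumR_nonneg (fun t => Cnorm2 (w t)) (r * r)) as [a [Ha _]]; eauto.
    intros; apply Cnorm2_pos. }
  set (iy := vscal (mkC 0 1) y).
  assert (Hiy : l2 iy) by (apply l2_scal, Hy).
  destruct (Hn (vadd x y)) as [a Ha]; [apply l2_add; auto|].
  destruct (Hn (vsub x y)) as [b Hb]; [apply l2_sub; auto|].
  destruct (Hn (vadd x iy)) as [c Hc]; [apply l2_add; auto|].
  destruct (Hn (vsub x iy)) as [d Hd]; [apply l2_sub; auto|].
  exists (mkC (/ 4 * (a - b)) (/ 4 * (c - d))); apply has_sumC_reim.
  - replace (fun t => re (Cmul (x t) (Cconj (y t)))) with
      (fun t => / 4 * (Cnorm2 (vadd x y t) + (-1) * Cnorm2 (vsub x y t))).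
    + apply has_sumR_polar; assumption.
    + apply functional_extensionality; intros t; unfold Cnorm2; simpl; field.
  - replace (fun t => im (Cmul (x t) (Cconj (y t)))) with
      (fun t => / 4 * (Cnorm2 (vadd x iy t) + (-1) * Cnorm2 (vsub x iy t))).
    + apply has_sumR_polar; assumption.
    + apply functional_extensionality; intros t; unfold Cnorm2, iy; simpl; field.
Qed.

Lemma inner_add_l x x' y z z' : inner x y z -> inner x' y z' -> inner (vadd x x') y (Cadd z z').
Proof.
  intros H H'; unfold Defs.inner.
  replace (fun t => Cmul (vadd x x' t) (Cconj (y t))) with
    (fun t => Cadd (Cmul (x t) (Cconj (y t))) (Cmul (x' t) (Cconj (y t))))
    by (apply functional_extensionality; intros; unfold Defs.vadd; ring).
  apply has_sumC_add; assumption.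
Qed.

Lemma inner_scal_l c x y z : inner x y z -> inner (vscal c x) y (Cmul c z).
Proof.
  intros H; unfold Defs.inner.
  replace (fun t => Cmul (vscal c x t) (Cconj (y t))) with
    (fun t => Cmul c (Cmul (x t) (Cconj (y t))))
    by (apply functional_extensionality; intros; unfold Defs.vscal; ring).
  apply has_sumC_scal; assumption.
Qed.

Lemma inner_conj x y z : inner x y z -> inner y x (Cconj z).
Proof.
  intros H; unfold Defs.inner.
  replace (fun t => Cmul (y t) (Cconj (x t))) with
    (fun t => Cconj (Cmul (x t) (Cconj (y t))))
    by (apply functional_extensionality; intros; rewrite Cconj_mul, Cconj_conj; ring).
  apply has_sumC_conj; assumption.
Qed.

Lemma inner_bound x y z r s : vnorm_le x r -> vnorm_le y s -> inner x y z -> Cabs z <= r * s.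
Proof.
  intros [Hr Hx] [Hs Hy]; apply has_sumC_bound; intros l Hl.
  specialize (Hx l Hl); specialize (Hy l Hl).
  set (f := fun t => Cabs (x t)); set (g := fun t => Cabs (y t)).
  eapply Rle_trans; [apply Cabs_lsumC|].
  assert (Hf : forall t, 0 <= f t) by (intros; apply Cabs_pos).
  assert (Hg : forall t, 0 <= g t) by (intros; apply Cabs_pos).
  pose proof (lsum_cauchy_schwarz f g l Hf Hg) as HCS.
  apply Rle_trans with (lsum (fun t => f t * g t) l).
  { apply lsum_le; intros t; rewrite Cabs_mul, Cabs_conj; apply Rle_refl. }
  apply le_of_sqr_le; [nra|]; eapply Rle_trans; [exact HCS|].
  replace (r * s * (r * s)) with ((r * r) * (s * s)) by ring.
  apply Rmult_le_compat; try (apply lsum_nonneg; intros; nra).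
  - eapply Rle_trans; [|exact Hx]; apply lsum_le; intros; unfold f; rewrite Cabs_sqr; lra.
  - eapply Rle_trans; [|exact Hy]; apply lsum_le; intros; unfold g; rewrite Cabs_sqr; lra.
Qed.

Lemma inner_delta_l s y : inner (delta s) y (Cconj (y s)).
Proof.
  unfold Defs.inner.
  replace (fun t => Cmul (delta s t) (Cconj (y t))) with
    (fun t => if dec (t = s) then Cconj (y s) else C0).
  - apply has_sumC_single.
  - apply functional_extensionality; intros t; unfold delta.
    destruct (dec (t = s)) as [->|]; ring.
Qed.

Lemma inner_delta_r x s : inner x (delta s) (x s).
Proof. rewrite <- (Cconj_conj (x s)); apply inner_conj, inner_delta_l. Qed.

(** A total function in place of the relation [inner], so that identities can be rewritten. It is
    meaningful where the sum exists, in particular on l2 by [ip_inner]. *)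
Definition ip x y : C := epsilon (inhabits C0) (inner x y).

Lemma ip_inner x y : l2 x -> l2 y -> inner x y (ip x y).
Proof.
  intros Hx Hy; apply (epsilon_spec (inhabits C0) (inner x y)), inner_ex; assumption.
Qed.

Lemma ip_eq x y z : inner x y z -> ip x y = z.
Proof.
  intros H; apply inner_unique with x y; [|exact H].
  apply (epsilon_spec (inhabits C0) (inner x y)); exists z; exact H.
Qed.

Lemma ip_add_l x x' y : l2 x -> l2 x' -> l2 y -> ip (vadd x x') y = Cadd (ip x y) (ip x' y).
Proof. intros; apply ip_eq, inner_add_l; apply ip_inner; assumption. Qed.

Lemma ip_scal_l c x y : l2 x -> l2 y -> ip (vscal c x) y = Cmul c (ip x y).
Proof. intros; apply ip_eq, inner_scal_l; apply ip_inner; assumption. Qed.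

Lemma ip_conj x y : l2 x -> l2 y -> ip y x = Cconj (ip x y).
Proof. intros; apply ip_eq, inner_conj, ip_inner; assumption. Qed.

Lemma ip_bound x y r s : vnorm_le x r -> vnorm_le y s -> Cabs (ip x y) <= r * s.
Proof.
  intros Hx Hy; apply inner_bound with x y; auto; apply ip_inner; [exists r|exists s]; assumption.
Qed.

(** The coordinate of the adjoint vector at t is forced to be <y, T delta_t>, the conjugate of <T
    delta_t, y>. Reading this as a definition gives an explicit adjoint without the Riesz
    representation theorem. *)
Definition adj T : op G := fun y t => Cconj (ip (T (delta t)) y).

Lemma adj_delta T s t : adj T (delta s) t = Cconj (T (delta t) s).
Proof. unfold adj; f_equal; apply ip_eq, inner_delta_r. Qed.

Lemma ip_fin T x y l : linear_l2 T -> (forall z, l2 z -> l2 (T z)) -> l2 y ->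
  ip (T (fin l x)) y = lsumC (fun t => Cmul (x t) (Cconj (adj T y t))) l.
Proof.
  intros L HT Hy; induction l as [|a l IH]; simpl.
  - rewrite linear_zero by exact L; apply ip_eq.
    replace vzero with (vscal C0 vzero) by vec_ring.
    replace C0 with (Cmul C0 (ip vzero y)) at 2 by ring.
    apply inner_scal_l, ip_inner; auto using l2_zero.
  - rewrite linear_add, linear_scal by auto using l2_scal, l2_delta, l2_fin.
    rewrite ip_add_l, ip_scal_l, IH by auto using l2_scal, l2_delta, l2_fin.
    unfold adj; rewrite Cconj_conj; reflexivity.
Qed.

(** Test T on the restriction of [adj T y] to a finite list: the inner product with y is exactly the
    squared norm q of that restriction. Cauchy-Schwarz gives q <= M s sqrt q, hence sqrt q <= M
    s. *)
Lemma adj_bounded_by T M : bounded_by T M -> bounded_by (adj T) M.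
Proof.
  intros HT; assert (HM : 0 <= M) by (destruct HT as [_ [HM _]]; exact HM).
  assert (Hl2 : forall z, l2 z -> l2 (T z)) by (intros; eapply op_le_l2; [apply HT|assumption]).
  split; split.
  - intros x y Hx Hy t; unfold adj, Defs.vadd at 2; rewrite <- Cconj_add; f_equal.
    rewrite !(ip_conj _ (T (delta t))) by auto using l2_add, l2_delta.
    rewrite ip_add_l, Cconj_add by auto using l2_delta; reflexivity.
  - intros c x Hx t; unfold adj, Defs.vscal at 2.
    rewrite !(ip_conj _ (T (delta t))) by auto using l2_scal, l2_delta.
    rewrite ip_scal_l, !Cconj_conj by auto using l2_delta; reflexivity.
  - exact HM.
  - intros y s Hy; pose proof (vnorm_le_pos _ _ Hy) as Hs; split; [apply Rmult_le_pos; assumption|].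
    intros l Hl.
    set (q := lsum (fun t => Cnorm2 (adj T y t)) l).
    assert (Hq : 0 <= q) by (apply lsum_nonneg; intros; apply Cnorm2_pos).
    assert (E : ip (T (fin l (adj T y))) y = mkC q 0).
    { rewrite ip_fin; [|apply HT|exact Hl2|exists s; exact Hy].
      unfold q; clear; induction l as [|a l IH]; simpl; [reflexivity|].
      rewrite IH; apply C_ext; unfold Cnorm2; simpl; ring. }
    pose proof (ip_bound _ _ _ _ (bounded_by_vnorm _ _ _ _ HT (vnorm_le_fin l (adj T y) Hl)) Hy) as H.
    fold q in H; rewrite E, (Cabs_of_norm2 _ q) in H by (unfold Cnorm2; simpl; lra).
    pose proof (sqrt_pos q) as H0; pose proof (sqrt_sqrt q Hq) as H1.
    set (h := sqrt q) in *; rewrite <- H1 in H |- *.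
    destruct (Req_dec h 0) as [->|n]; [nra|].
    assert (h <= M * s) by nra; nra.
Qed.

Lemma adj_bounded T : bounded G T -> bounded G (adj T).
Proof. rewrite !bounded_iff; intros [M H]; exists M; apply adj_bounded_by, H. Qed.

(** The identity is exact for finitely supported x and extends by density. A tail of norm d
    contributes at most d M s on either side, whence the choice of d. *)
Lemma adj_is_adjoint T : bounded G T -> is_adjoint T (adj T).
Proof.
  intros HB x y Hx Hy; pose proof HB as HB'; apply bounded_iff in HB'; destruct HB' as [M HT].
  assert (HM : 0 <= M) by (destruct HT as [_ [HM _]]; exact HM).
  assert (Ha := adj_bounded_by T M HT).
  assert (HTl : forall z, l2 z -> l2 (T z)) by (intros; apply bounded_l2; auto).
  assert (Hal : l2 (adj T y)) by (apply bounded_l2; auto; eapply bounded_by_bounded; eauto).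
  exists (ip (T x) y); split; [apply ip_inner; auto|].
  replace (ip (T x) y) with (ip x (adj T y)); [apply ip_inner; auto|].
  assert (Hf : forall l, ip (fin l x) (adj T y) = ip (T (fin l x)) y).
  { intros l; rewrite ip_fin; [|apply HT|exact HTl|exact Hy].
    change (fin l x) with (opid G (fin l x)).
    rewrite ip_fin; [|apply bounded_by_id|auto|exact Hal].
    apply lsumC_ext; intros t; do 2 f_equal; unfold adj at 1, opid.
    rewrite (ip_eq _ _ _ (inner_delta_l t (adj T y))), Cconj_conj; reflexivity. }
  destruct Hy as [s Hy]; pose proof (vnorm_le_pos _ _ Hy) as Hs.
  apply C_eq_of_close; intros e He.
  set (d := e / (2 * (M * s) + 1)).
  assert (HMs : 0 <= M * s) by (apply Rmult_le_pos; assumption).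
  assert (Hd : 0 < d) by (apply Rdiv_lt_0_compat; lra).
  destruct (fin_tail x d Hx Hd) as [l [_ Hl]]; specialize (Hf l).
  set (w := vsub x (fin l x)) in *.
  assert (Hw : l2 w) by (exists d; exact Hl).
  replace x with (vadd w (fin l x)) by (unfold w; vec_ring).
  rewrite linear_add by (try apply HT; auto using l2_fin).
  rewrite !ip_add_l, Hf by (auto using l2_fin; exists s; exact Hy).
  replace (Csub (Cadd (ip w (adj T y)) (ip (T (fin l x)) y))
             (Cadd (ip (T w) y) (ip (T (fin l x)) y)))
    with (Cadd (ip w (adj T y)) (Copp (ip (T w) y))) by ring.
  eapply Rle_trans; [apply Cabs_triangle|]; rewrite Cabs_opp.
  pose proof (ip_bound _ _ _ _ Hl (bounded_by_vnorm _ _ _ _ Ha Hy)) as H1.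
  pose proof (ip_bound _ _ _ _ (bounded_by_vnorm _ _ _ _ HT Hl) Hy) as H2.
  assert (d * (2 * (M * s) + 1) = e) by (unfold d; field; lra); nra.
Qed.

(** Testing against basis vectors shows that adjoints are unique on l2. Every adjoint given as a
    relation can thus be traded for [adj]. *)
Lemma is_adjoint_eq_adj T S : is_adjoint T S -> op_eq G S (adj T).
Proof.
  intros H y Hy t; destruct (H (delta t) y (l2_delta t) Hy) as [z [H1 H2]].
  unfold adj; rewrite (ip_eq _ _ _ H1), (inner_unique _ _ _ _ H2 (inner_delta_l t (S y))).
  symmetry; apply Cconj_conj.
Qed.

Lemma is_adjoint_sym T S : is_adjoint T S -> is_adjoint S T.
Proof.
  intros H x y Hx Hy; destruct (H y x Hy Hx) as [z [H1 H2]].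
  exists (Cconj z); split; apply inner_conj; assumption.
Qed.

Lemma is_adjoint_comp T T' S S' :
  (forall x, l2 x -> l2 (T' x)) -> (forall x, l2 x -> l2 (S x)) ->
  is_adjoint T S -> is_adjoint T' S' -> is_adjoint (opcomp G T T') (opcomp G S' S).
Proof.
  intros HT' HS H H' x y Hx Hy.
  destruct (H (T' x) y (HT' x Hx) Hy) as [z [H1 H2]].
  destruct (H' x (S y) Hx (HS y Hy)) as [z' [H1' H2']].
  rewrite (inner_unique _ _ _ _ H2 H1') in H1; exists z'; split; assumption.
Qed.

Lemma adj_comp T S : bounded G T -> bounded G S ->
  op_eq G (adj (opcomp G T S)) (opcomp G (adj S) (adj T)).
Proof.
  intros HT HS x Hx t; symmetry; revert x Hx t; apply is_adjoint_eq_adj, is_adjoint_comp.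
  - intros; apply bounded_l2; assumption.
  - intros; apply bounded_l2; auto using adj_bounded.
  - apply adj_is_adjoint, HT.
  - apply adj_is_adjoint, HS.
Qed.

End Hilbert.

(** * Uniform locality *)

Section Locality.
Context {G : group}.
Implicit Types (y : G) (T S : op G) (A B : nat -> op G) (Y : nat -> G -> Prop).
Local Notation vadd := (Defs.vadd G).
Local Notation vsub := (Defs.vsub G).
Local Notation vscal := (Defs.vscal G).
Local Notation vzero := (Defs.vzero G).
Local Notation vnorm_le := (Defs.vnorm_le G).
Local Notation l2 := (Defs.l2 G).
Local Notation proj := (Defs.proj G).

(** A pair (f, c) stands for c delta_{f y}. Positions are relative to y, so one finite carrier
    serves all columns, and repetitions are allowed, so sums become concatenations. The sum [csum]
    of the moduli of the coefficients controls the error when another operator is applied term by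
    term. *)
Definition comb (L : list (G * C)) (y : G) : vec G :=
  fold_right (fun p acc => vadd (vscal (snd p) (delta (gmul (fst p) y))) acc) vzero L.
Definition csum (L : list (G * C)) : R := fold_right (fun p acc => Cabs (snd p) + acc) 0 L.
Definition inside (F : list G) (y : G) (X : G -> Prop) : Prop :=
  forall f, In f F -> X (gmul f y).
Definition supported (L : list (G * C)) (F : list G) : Prop :=
  forall p, In p L -> In (fst p) F.

(* The columns of [A k] at [y] are, up to [e], one and the same combination [L], carried by
   [F y], for all [k] such that [F y] lies in [Y k]. Unlike convergence alone, this is stable
   under products, and it is uniform in [y], as limit operators require. *)
Definition local_seq Y A : Prop :=
  forall e, 0 < e -> exists F K, 0 <= K /\ forall y, exists L,
    supported L F /\ csum L <= K /\
    forall k, inside F y (Y k) -> vnorm_le (vsub (A k (delta y)) (comb L y)) e.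

Lemma inside_app F1 F2 y X : inside (F1 ++ F2) y X -> inside F1 y X /\ inside F2 y X.
Proof. intros H; split; intros f Hf; apply H, in_or_app; auto. Qed.

Lemma comb_app L1 L2 y : comb (L1 ++ L2) y = vadd (comb L1 y) (comb L2 y).
Proof.
  induction L1 as [|p L IH]; simpl; [|rewrite IH]; vec_ring.
Qed.

Lemma csum_app L1 L2 : csum (L1 ++ L2) = csum L1 + csum L2.
Proof. induction L1 as [|p L IH]; simpl; [|rewrite IH]; ring. Qed.

Lemma csum_pos L : 0 <= csum L.
Proof.
  induction L as [|p L IH]; simpl; [lra|]; pose proof (Cabs_pos (snd p)); lra.
Qed.

(** Rebases a combination from the point f y to the point y, with a factor c. It is what composition
    does to one term of a column. *)
Definition move (c : C) (f : G) (L : list (G * C)) : list (G * C) :=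
  map (fun p => (gmul (fst p) f, Cmul c (snd p))) L.

Lemma comb_move c f L y : comb (move c f L) y = vscal c (comb L (gmul f y)).
Proof.
  induction L as [|p L IH]; [simpl; vec_ring|].
  change (vadd (vscal (Cmul c (snd p)) (delta (gmul (gmul (fst p) f) y))) (comb (move c f L) y) =
    vscal c (vadd (vscal (snd p) (delta (gmul (fst p) (gmul f y)))) (comb L (gmul f y)))).
  rewrite IH, gmulA; vec_ring.
Qed.

Lemma csum_move c f L : csum (move c f L) = Cabs c * csum L.
Proof.
  induction L as [|p L IH]; [simpl; ring|].
  change (Cabs (Cmul c (snd p)) + csum (move c f L) = Cabs c * (Cabs (snd p) + csum L)).
  rewrite IH, Cabs_mul; ring.
Qed.

Lemma local_seq_ext Y A B :
  (forall k y, A k (delta y) = B k (delta y)) -> local_seq Y A -> local_seq Y B.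
Proof.
  intros E H e He; destruct (H e He) as [F [K [HK HL]]]; exists F, K; split; [exact HK|].
  intros y; destruct (HL y) as [L [H1 [H2 H3]]]; exists L; split; [exact H1|split; [exact H2|]].
  intros k Hk; rewrite <- E; apply H3, Hk.
Qed.

Lemma local_seq_add Y A B :
  local_seq Y A -> local_seq Y B -> local_seq Y (fun k => opadd G (A k) (B k)).
Proof.
  intros HA HB e He.
  destruct (HA (e / 2)) as [F1 [K1 [HK1 HL1]]]; [lra|].
  destruct (HB (e / 2)) as [F2 [K2 [HK2 HL2]]]; [lra|].
  exists (F1 ++ F2), (K1 + K2); split; [lra|]; intros y.
  destruct (HL1 y) as [L1 [S1 [C1 E1]]]; destruct (HL2 y) as [L2 [S2 [C2 E2]]].
  exists (L1 ++ L2); split; [|split].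
  - intros p Hp; apply in_or_app; apply in_app_or in Hp; destruct Hp; auto.
  - rewrite csum_app; lra.
  - intros k Hk; apply inside_app in Hk; destruct Hk as [Hk1 Hk2].
    rewrite comb_app; unfold opadd.
    replace (vsub (vadd (A k (delta y)) (B k (delta y))) (vadd (comb L1 y) (comb L2 y)))
      with (vadd (vsub (A k (delta y)) (comb L1 y)) (vsub (B k (delta y)) (comb L2 y))) by vec_ring.
    replace e with (e / 2 + e / 2) by field; apply vnorm_le_add; auto.
Qed.

Lemma local_seq_scal Y A (c : C) : local_seq Y A -> local_seq Y (fun k => opscal G c (A k)).
Proof.
  intros HA e He; pose proof (Cabs_pos c) as Hc.
  destruct (HA (e / (Cabs c + 1))) as [F [K [HK HL]]]; [apply Rdiv_lt_0_compat; lra|].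
  exists F, (Cabs c * K); split; [apply Rmult_le_pos; assumption|]; intros y.
  destruct (HL y) as [L [S1 [C1 E1]]].
  exists (map (fun p => (fst p, Cmul c (snd p))) L).
  assert (E : comb (map (fun p => (fst p, Cmul c (snd p))) L) y = vscal c (comb L y)).
  { clear; induction L as [|p L IH]; simpl; [|rewrite IH]; vec_ring. }
  split; [|split].
  - intros p Hp; apply in_map_iff in Hp; destruct Hp as [q [<- Hq]]; exact (S1 q Hq).
  - apply Rle_trans with (Cabs c * csum L); [|apply Rmult_le_compat_l; assumption].
    clear; induction L as [|p L IH]; simpl; [lra|]; rewrite Cabs_mul; lra.
  - intros k Hk; rewrite E; unfold opscal.
    replace (vsub (vscal c (A k (delta y))) (vscal c (comb L y)))
      with (vscal c (vsub (A k (delta y)) (comb L y))) by vec_ring.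
    eapply vnorm_le_weaken; [|apply vnorm_le_scal, E1, Hk].
    replace e with ((Cabs c + 1) * (e / (Cabs c + 1))) at 2 by (field; lra).
    apply Rmult_le_compat_r; [left; apply Rdiv_lt_0_compat|]; lra.
Qed.

Lemma l2_comb L y : l2 (comb L y).
Proof.
  induction L as [|p L IH]; simpl; [apply l2_zero|].
  apply l2_add; [apply l2_scal, l2_delta|exact IH].
Qed.

(** Replace the column of B at y by a combination over FB, then the column of A at each point f y by
    one over FA. The result is carried by the products of FA and FB. The bound on [csum] is what
    keeps the total error of the second replacement uniform in y. *)
Lemma local_seq_comp Y A B M :
  (forall k, bounded_by (A k) M) -> (forall k y, l2 (B k (delta y))) ->
  local_seq Y A -> local_seq Y B -> local_seq Y (fun k => opcomp G (A k) (B k)).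
Proof.
  intros HM Hl2 HA HB e He.
  assert (HM0 : 0 <= M) by (destruct (HM 0%nat) as [_ [H _]]; exact H).
  destruct (HB (e / 2 / (M + 1))) as [FB [KB [HKB HLB]]]; [apply Rdiv_lt_0_compat; lra|].
  (* The tolerance for A is fixed only now: its errors get multiplied by coefficients of total
     modulus at most KB. *)
  set (e2 := e / 2 / (KB + 1)).
  assert (He2 : 0 < e2) by (apply Rdiv_lt_0_compat; lra).
  destruct (HA e2 He2) as [FA [KA [HKA HLA]]].
  (* FB is kept next to the products, because the approximation of B requires FB y to lie in Y k as
     well. *)
  set (F := FB ++ flat_map (fun f => map (fun g => gmul g f) FA) FB).
  assert (HF : forall f g, In f FB -> In g FA -> In (gmul g f) F).
  { intros f g Hf Hg; apply in_or_app; right; apply in_flat_map; exists f; split; [exact Hf|].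
    apply in_map_iff; exists g; split; [reflexivity|exact Hg]. }
  exists F, (KB * KA); split; [apply Rmult_le_pos; assumption|]; intros y.
  assert (Hstep : forall L, supported L FB -> exists L', supported L' F /\
     csum L' <= csum L * KA /\
     forall k, inside F y (Y k) -> vnorm_le (vsub (A k (comb L y)) (comb L' y)) (csum L * e2)).
  { induction L as [|[f c] L IH]; intros HS.
    - exists []; split; [intros p []|split; [simpl; lra|]].
      intros k _; simpl; rewrite (linear_zero (A k)) by apply (HM k).
      apply vnorm_le_self_sub; lra.
    - destruct IH as [L1 [S1 [C1 E1]]]; [intros p Hp; apply HS; right; exact Hp|].
      assert (Hf : In f FB) by exact (HS (f, c) (or_introl eq_refl)).
      destruct (HLA (gmul f y)) as [L2 [S2 [C2 E2]]].
      exists (move c f L2 ++ L1); split; [|split].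
      + intros p Hp; apply in_app_or in Hp; destruct Hp as [Hp|Hp]; [|apply S1, Hp].
        apply in_map_iff in Hp; destruct Hp as [q [<- Hq]]; simpl; auto.
      + rewrite csum_app, csum_move; simpl; pose proof (Cabs_pos c); nra.
      + intros k Hk.
        assert (Hk2 : inside FA (gmul f y) (Y k)).
        { intros g Hg; rewrite gmulA; apply Hk, HF; assumption. }
        rewrite comb_app, comb_move; simpl.
        rewrite (linear_add (A k)), (linear_scal (A k))
          by (try apply (HM k); auto using l2_scal, l2_delta, l2_comb).
        replace (vsub (vadd (vscal c (A k (delta (gmul f y)))) (A k (comb L y)))
                   (vadd (vscal c (comb L2 (gmul f y))) (comb L1 y)))
          with (vadd (vscal c (vsub (A k (delta (gmul f y))) (comb L2 (gmul f y))))
                  (vsub (A k (comb L y)) (comb L1 y))) by vec_ring.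
        rewrite Rmult_plus_distr_r; apply vnorm_le_add; [|apply E1, Hk].
        apply vnorm_le_scal, E2, Hk2. }
  destruct (HLB y) as [L [S1 [C1 E1]]]; destruct (Hstep L S1) as [L' [S2 [C2 E2]]].
  exists L'; split; [exact S2|split].
  - pose proof (csum_pos L); nra.
  - intros k Hk; pose proof Hk as Hk1; apply inside_app in Hk1; destruct Hk1 as [Hk1 _].
    specialize (E1 k Hk1); specialize (E2 k Hk); unfold opcomp.
    apply vnorm_le_weaken with (M * (e / 2 / (M + 1)) + csum L * e2).
    + assert (csum L * e2 <= e / 2).
      { replace (e / 2) with ((KB + 1) * e2) by (unfold e2; field; lra).
        apply Rmult_le_compat_r; lra. }
      assert (0 < e / 2 / (M + 1)) by (apply Rdiv_lt_0_compat; lra).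
      assert ((M + 1) * (e / 2 / (M + 1)) = e / 2) by (field; lra); lra.
    + eapply vnorm_le_sub_trans; [|exact E2].
      rewrite <- (linear_sub (A k)) by (try apply (HM k); auto using l2_comb).
      eapply bounded_by_vnorm; [apply HM|exact E1].
Qed.

(** Carrier and coefficient bound may depend on the tolerance, so those of a close enough
    approximant serve. *)
Lemma local_seq_lim Y B :
  (forall e, 0 < e -> exists A, local_seq Y A /\
     forall k y, vnorm_le (vsub (B k (delta y)) (A k (delta y))) e) ->
  local_seq Y B.
Proof.
  intros H e He; destruct (H (e / 2)) as [A [HA E]]; [lra|].
  destruct (HA (e / 2)) as [F [K [HK HL]]]; [lra|].
  exists F, K; split; [exact HK|]; intros y; destruct (HL y) as [L [S1 [C1 E1]]].
  exists L; split; [exact S1|split; [exact C1|]]; intros k Hk.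
  replace e with (e / 2 + e / 2) by field; eapply vnorm_le_sub_trans; [apply E|apply E1, Hk].
Qed.

Lemma adj_add_delta T S y :
  adj (opadd G T S) (delta y) = vadd (adj T (delta y)) (adj S (delta y)).
Proof.
  apply vec_ext; intros t; unfold Defs.vadd; rewrite !adj_delta, <- Cconj_add; reflexivity.
Qed.

Lemma adj_scal_delta c T y :
  adj (opscal G c T) (delta y) = vscal (Cconj c) (adj T (delta y)).
Proof.
  apply vec_ext; intros t; unfold Defs.vscal; rewrite !adj_delta, <- Cconj_mul; reflexivity.
Qed.

Lemma adj_sub_delta T S y :
  adj (opsub G T S) (delta y) = vsub (adj T (delta y)) (adj S (delta y)).
Proof.
  apply vec_ext; intros t; unfold Defs.vsub; rewrite !adj_delta, <- Cconj_sub; reflexivity.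
Qed.

Lemma adj_comp_delta T S y : bounded G T -> bounded G S ->
  adj (opcomp G T S) (delta y) = adj S (adj T (delta y)).
Proof. intros HT HS; apply vec_ext, adj_comp; auto using l2_delta. Qed.

Lemma adj_close T S e : bounded G T -> bounded G S -> Defs.op_le G (opsub G T S) e ->
  forall y, vnorm_le (vsub (T (delta y)) (S (delta y))) e /\
            vnorm_le (vsub (adj T (delta y)) (adj S (delta y))) e.
Proof.
  intros HT HS H y; rewrite bounded_iff in HT, HS; destruct HT as [M HT]; destruct HS as [N HS].
  assert (HD : bounded_by (opsub G T S) e)
    by (split; [apply (bounded_by_sub _ _ _ _ HT HS)|exact H]).
  rewrite <- (Rmult_1_r e), <- adj_sub_delta; split.
  - apply HD, vnorm_le_delta.
  - apply (bounded_by_vnorm _ _ _ _ (adj_bounded_by _ _ HD) (vnorm_le_delta y)).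
Qed.

(** * The algebras BDO and S_Y *)

(** A single operator is treated as a constant sequence with every Y_n equal to G, so that operators
    and sequences share the same closure lemmas. *)
Definition local_op T : Prop := local_seq (fun _ _ => True) (fun _ => T).

(** Covers the generators of BDO and their adjoints: each column has a single entry, at a
    displacement from a finite list. *)
Lemma local_op_single T (p : G -> G) (c : G -> C) (F : list G) K :
  0 <= K -> (forall y, In (p y) F) -> (forall y, Cabs (c y) <= K) ->
  (forall y t, T (delta y) t = if dec (t = gmul (p y) y) then c y else C0) -> local_op T.
Proof.
  intros HK HF Hc E e He; exists F, K; split; [exact HK|]; intros y.
  exists [(p y, c y)]; split; [|split].
  - intros q [<-|[]]; simpl; auto.
  - simpl; specialize (Hc y); lra.
  - intros _ _; simpl.
    replace (T (delta y)) with (vadd (vscal (c y) (delta (gmul (p y) y))) vzero).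
    + apply vnorm_le_self_sub; lra.
    + apply vec_ext; intros t; rewrite E; unfold Defs.vadd, Defs.vscal, Defs.vzero, delta.
      destruct (dec (t = gmul (p y) y)); ring.
Qed.

Lemma ginv_mul_eq (r s t : G) : gmul (ginv r) s = t <-> s = gmul r t.
Proof.
  split; [intros <-|intros ->]; rewrite gmulA, ?gmulVr, ?gmulVl, gmul1l; reflexivity.
Qed.

Lemma Lop_delta r y : Lop G r (delta y) = delta (gmul r y).
Proof.
  apply vec_ext; intros t; unfold Lop, delta.
  destruct (dec (gmul (ginv r) t = y)) as [i|i]; destruct (dec (t = gmul r y)) as [j|j];
    try reflexivity; rewrite ginv_mul_eq in i; contradiction.
Qed.

(** The property fed into the minimality of BDO. The condition on the adjoint is included because a
    closed subalgebra, as defined, has no adjoint operation from which to recover it. *)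
Definition local_star T : Prop := bounded G T /\ local_op T /\ local_op (adj T).

Lemma local_star_Lop r : local_star (Lop G r).
Proof.
  split; [eapply bounded_by_bounded, bounded_by_Lop|split].
  - apply local_op_single with (fun _ => r) (fun _ => C1) [r] 1;
      [lra|simpl; auto|rewrite Cabs_1; intros; lra|].
    intros y t; rewrite Lop_delta; reflexivity.
  - apply local_op_single with (fun _ => ginv r) (fun _ => C1) [ginv r] 1;
      [lra|simpl; auto|rewrite Cabs_1; intros; lra|].
    intros y t; rewrite adj_delta, Lop_delta; unfold delta.
    destruct (dec (y = gmul r t)) as [i|i]; destruct (dec (t = gmul (ginv r) y)) as [j|j];
      rewrite ?Cconj_1, ?Cconj_0; try reflexivity; exfalso.
    + apply j; symmetry; apply ginv_mul_eq, i.
    + apply i; apply ginv_mul_eq; symmetry; exact j.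
Qed.

Lemma mulop_delta a y t : mulop G a (delta y) t = if dec (t = gmul gone y) then a y else C0.
Proof.
  rewrite gmul1l; unfold mulop, delta; destruct (dec (t = y)) as [->|]; ring.
Qed.

Lemma local_star_mulop a : linf G a -> local_star (mulop G a).
Proof.
  (* [linf] bounds squared moduli, hence the square root. *)
  intros [M HM]; set (K := sqrt (Rabs M)).
  assert (HK : 0 <= K) by apply sqrt_pos.
  assert (Ha : forall t, Cabs (a t) <= K).
  { intros t; apply sqrt_le_1_alt; eapply Rle_trans; [apply HM|apply Rle_abs]. }
  split; [eapply bounded_by_bounded, bounded_by_mulop; eauto|split].
  - apply local_op_single with (fun _ => gone) a [gone] K; simpl; auto.
    apply mulop_delta.
  - apply local_op_single with (fun _ => gone) (fun t => Cconj (a t)) [gone] K; simpl; auto.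
    + intros y; rewrite Cabs_conj; auto.
    + intros y t; rewrite adj_delta, mulop_delta, !gmul1l.
      destruct (dec (y = t)) as [->|i]; destruct (dec (t = _)) as [j|j];
        rewrite ?Cconj_0; try reflexivity; congruence.
Qed.

Lemma local_star_closed : closed_subalgebra G local_star.
Proof.
  assert (Hl2 : forall T y, bounded G T -> l2 (T (delta y)))
    by (intros; apply bounded_l2; auto using l2_delta).
  split; [|split; [|split; [|split]]].
  - intros T HT; apply HT.
  - intros T S [HT [LT LT']] [HS [LS LS']]; split; [|split].
    + rewrite bounded_iff in HT, HS; destruct HT as [M HM]; destruct HS as [N HN].
      apply (bounded_by_bounded _ _ (bounded_by_add _ _ _ _ HM HN)).
    + apply local_seq_add; assumption.
    + eapply local_seq_ext; [|apply local_seq_add; [exact LT'|exact LS']].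
      intros k y; symmetry; apply adj_add_delta.
  - intros c T [HT [LT LT']]; split; [|split].
    + rewrite bounded_iff in HT; destruct HT as [M HM].
      apply (bounded_by_bounded _ _ (bounded_by_scal c _ _ HM)).
    + apply local_seq_scal, LT.
    + eapply local_seq_ext; [|apply local_seq_scal, LT'].
      intros k y; symmetry; apply adj_scal_delta.
  - intros T S [HT [LT LT']] [HS [LS LS']].
    pose proof HT as HT'; pose proof HS as HS'.
    rewrite bounded_iff in HT', HS'; destruct HT' as [M HM]; destruct HS' as [N HN].
    split; [|split].
    + apply (bounded_by_bounded _ _ (bounded_by_comp _ _ _ _ HM HN)).
    + apply local_seq_comp with M; auto.
    (* Taking adjoints reverses the product, so the outer factor is now the adjoint of S, with bound
       N. *)
    + eapply local_seq_ext; [|apply local_seq_comp with (M := N); [| |exact LS'|exact LT']].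
      * intros k y; symmetry; apply adj_comp_delta; assumption.
      * intros; apply adj_bounded_by, HN.
      * intros; apply Hl2, adj_bounded, HT.
  - intros T HT H; split; [exact HT|split].
    + apply local_seq_lim; intros e He; destruct (H e He) as [S [[HS [LS _]] E]].
      exists (fun _ => S); split; [exact LS|]; intros _ y; apply adj_close; assumption.
    + apply local_seq_lim; intros e He; destruct (H e He) as [S [[HS [_ LS]] E]].
      exists (fun _ => adj S); split; [exact LS|]; intros _ y; apply adj_close; assumption.
Qed.

Lemma BDO_local_star T : BDO G T -> local_star T.
Proof.
  intros H; apply H; [exact local_star_closed|exact local_star_Lop|exact local_star_mulop].
Qed.

Lemma proj_delta P y : P y -> proj P (delta y) = delta y.
Proof.
  intros H; apply vec_ext; intros t; unfold Defs.proj, delta.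
  destruct (dec (t = y)) as [->|]; destruct (dec (P _)); tauto.
Qed.

Lemma proj_delta_out P y : ~ P y -> proj P (delta y) = vzero.
Proof.
  intros H; apply vec_ext; intros t; unfold Defs.proj, delta, Defs.vzero.
  destruct (dec (P t)); destruct (dec (t = y)) as [->|]; tauto.
Qed.

Lemma proj_comb P F L y : supported L F -> inside F y P -> proj P (comb L y) = comb L y.
Proof.
  intros HS HI; apply vec_ext; intros t; unfold Defs.proj; destruct (dec (P t)) as [|n]; [reflexivity|].
  induction L as [|p L IH]; simpl; [reflexivity|].
  unfold Defs.vadd, Defs.vscal; rewrite <- IH by (intros q Hq; apply HS; right; exact Hq).
  unfold delta; destruct (dec (t = gmul (fst p) y)) as [->|]; [|ring].
  elim n; apply HI, HS; left; reflexivity.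
Qed.

(** Here the restriction to those k with F y inside Y k originates: for them the inner projection
    fixes delta_y and the outer one fixes the approximating combination. *)
Lemma local_seq_compress Y T :
  local_op T -> local_seq Y (fun n => opcomp G (proj (Y n)) (opcomp G T (proj (Y n)))).
Proof.
  intros H e He; destruct (H e He) as [F [K [HK HL]]].
  (* The identity is added to the carrier so that y itself lies in Y k. *)
  exists (gone :: F), K; split; [exact HK|]; intros y; destruct (HL y) as [L [S1 [C1 E1]]].
  exists L; split; [intros p Hp; right; apply S1, Hp|split; [exact C1|]]; intros k Hk.
  assert (Hy : Y k y) by (rewrite <- (gmul1l _ y); apply Hk; left; reflexivity).
  assert (HF : inside F y (Y k)) by (intros f Hf; apply Hk; right; exact Hf).
  unfold opcomp; rewrite proj_delta, <- (proj_comb (Y k) F L y S1 HF) by exact Hy.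
  replace (vsub (proj (Y k) (T (delta y))) (proj (Y k) (comb L y)))
    with (proj (Y k) (vsub (T (delta y)) (comb L y))).
  - apply vnorm_le_proj, (E1 0%nat); intros f _; exact I.
  - apply vec_ext; intros t; unfold Defs.vsub, Defs.proj; destruct (dec (Y k t)); ring.
Qed.

Lemma adj_compress_delta P T y : bounded G T ->
  adj (opcomp G (proj P) (opcomp G T (proj P))) (delta y) =
  opcomp G (proj P) (opcomp G (adj T) (proj P)) (delta y).
Proof.
  intros HT; apply vec_ext; intros t; rewrite adj_delta; unfold opcomp.
  unfold Defs.proj at 1 3; destruct (dec (P y)) as [Hy|Hy].
  - rewrite (proj_delta P y Hy); destruct (dec (P t)) as [Ht|Ht].
    + rewrite (proj_delta P t Ht), adj_delta; reflexivity.
    + rewrite (proj_delta_out P t Ht), (linear_zero T) by apply HT; apply Cconj_0.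
  - rewrite (proj_delta_out P y Hy), (linear_zero (adj T)) by (apply adj_bounded; exact HT).
    rewrite Cconj_0; destruct (dec (P t)); reflexivity.
Qed.

Lemma compressed_proj P T x : compressed G P T -> l2 x -> T x = proj P (T (proj P x)).
Proof. intros H Hx; apply vec_ext, H, Hx. Qed.

Lemma compressed_out P T x t : compressed G P T -> l2 x -> ~ P t -> T x t = C0.
Proof.
  intros H Hx Ht; rewrite (H x Hx t); unfold Defs.proj at 1; destruct (dec (P t)); tauto.
Qed.

Lemma proj_proj P (u : vec G) : proj P (proj P u) = proj P u.
Proof. apply vec_ext; intros t; unfold Defs.proj; destruct (dec (P t)); reflexivity. Qed.

Lemma compressed_comp_proj P T x : compressed G P T -> l2 x -> T (proj P x) = T x.
Proof.
  intros H Hx; rewrite (compressed_proj P T (proj P x) H) by (apply l2_proj, Hx).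
  rewrite proj_proj; symmetry; apply compressed_proj; assumption.
Qed.

Lemma compressed_add P T S :
  compressed G P T -> compressed G P S -> compressed G P (opadd G T S).
Proof.
  intros HT HS x Hx t; unfold opadd, Defs.vadd; rewrite (HT x Hx t), (HS x Hx t).
  unfold Defs.proj at 1 3 5; destruct (dec (P t)); ring.
Qed.

Lemma compressed_scal P c T : compressed G P T -> compressed G P (opscal G c T).
Proof.
  intros HT x Hx t; unfold opscal, Defs.vscal; rewrite (HT x Hx t).
  unfold Defs.proj at 1 3; destruct (dec (P t)); ring.
Qed.

Lemma compressed_comp P T S : (forall x, l2 x -> l2 (S x)) ->
  compressed G P T -> compressed G P S -> compressed G P (opcomp G T S).
Proof.
  intros Hl2 HT HS x Hx t; unfold opcomp.
  rewrite (compressed_comp_proj P S x HS Hx), (HT (S x) (Hl2 x Hx) t).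
  rewrite (compressed_comp_proj P T (S x) HT (Hl2 x Hx)); reflexivity.
Qed.

Lemma bseq_bounded_by Y A : bseq G Y A -> exists M, 0 <= M /\ forall n, bounded_by (A n) M.
Proof.
  intros [H [M HM]]; exists M; split; [exact (proj1 (HM 0%nat))|].
  intros n; split; [apply (H n)|apply HM].
Qed.

Definition local_star_seq Y A : Prop :=
  bseq G Y A /\ local_seq Y A /\ local_seq Y (fun n => adj (A n)).

Lemma local_star_seq_closed Y : cstar_closed G Y (local_star_seq Y).
Proof.
  assert (Hl2 : forall T y, bounded G T -> l2 (T (delta y)))
    by (intros; apply bounded_l2; auto using l2_delta).
  assert (Hbseq : forall A M, (forall n, compressed G (Y n) (A n)) ->
            (forall n, bounded_by (A n) M) -> bseq G Y A).
  { intros A M HA HM; split; [|exists M; intros n; apply (HM n)].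
    intros n; split; [apply HA|eapply bounded_by_bounded, HM]. }
  split; [|split; [|split; [|split; [|split]]]].
  - intros A HA; apply HA.
  - intros A B [HA [LA LA']] [HB [LB LB']]; split; [|split].
    + destruct (bseq_bounded_by Y A HA) as [M [_ HM]]; destruct (bseq_bounded_by Y B HB) as [N [_ HN]].
      apply Hbseq with (M + N); [|intros; apply bounded_by_add; auto].
      intros n; apply compressed_add; [apply HA|apply HB].
    + apply local_seq_add; assumption.
    + eapply local_seq_ext; [|apply local_seq_add; [exact LA'|exact LB']].
      intros n y; symmetry; apply adj_add_delta.
  - intros c A [HA [LA LA']]; split; [|split].
    + destruct (bseq_bounded_by Y A HA) as [M [_ HM]].
      apply Hbseq with (Cabs c * M); [|intros; apply bounded_by_scal; auto].
      intros n; apply compressed_scal, HA.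
    + apply local_seq_scal; assumption.
    + eapply local_seq_ext; [|apply local_seq_scal; exact LA'].
      intros n y; symmetry; apply adj_scal_delta.
  - intros A B [HA [LA LA']] [HB [LB LB']].
    destruct (bseq_bounded_by Y A HA) as [M [_ HM]]; destruct (bseq_bounded_by Y B HB) as [N [_ HN]].
    split; [|split].
    + apply Hbseq with (M * N); [|intros; apply bounded_by_comp; auto].
      intros n; apply compressed_comp; [|apply HA|apply HB].
      intros x Hx; apply bounded_l2; [apply HB|exact Hx].
    + apply local_seq_comp with M; auto; intros; apply Hl2, HB.
    + eapply local_seq_ext; [|apply local_seq_comp with (M := N); [| |exact LB'|exact LA']].
      * intros n y; symmetry; apply adj_comp_delta; [apply HA|apply HB].
      * intros; apply adj_bounded_by, HN.
      * intros; apply Hl2, adj_bounded, HA.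
  - intros A B [HA [LA LA']] HB.
    destruct (bseq_bounded_by Y A HA) as [M [_ HM]].
    (* By uniqueness of adjoints, B n is [adj (A n)] and A n is [adj (B n)] on l2, so the two
       locality conditions merely exchange roles. *)
    assert (E : forall n, op_eq G (B n) (adj (A n)))
      by (intros n; apply is_adjoint_eq_adj, (proj2 (proj2 (HB n)))).
    assert (E' : forall n, op_eq G (A n) (adj (B n)))
      by (intros n; apply is_adjoint_eq_adj, is_adjoint_sym, (proj2 (proj2 (HB n)))).
    split; [|split].
    + apply Hbseq with M; [intros n; apply (HB n)|].
      intros n; apply bounded_by_op_eq with (adj (A n)); [|apply adj_bounded_by, HM].
      intros x Hx t; symmetry; apply E, Hx.
    + eapply local_seq_ext; [|exact LA'].
      intros n y; apply vec_ext; intros t; symmetry; apply E, l2_delta.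
    + eapply local_seq_ext; [|exact LA].
      intros n y; apply vec_ext; intros t; apply E', l2_delta.
  - intros B HB H; split; [exact HB|split].
    + apply local_seq_lim; intros e He; destruct (H e He) as [A [[HA [LA _]] E]].
      exists A; split; [exact LA|]; intros n y; apply adj_close; [apply HB|apply HA|apply E].
    + apply local_seq_lim; intros e He; destruct (H e He) as [A [[HA [_ LA]] E]].
      exists (fun n => adj (A n)); split; [exact LA|]; intros n y.
      apply adj_close; [apply HB|apply HA|apply E].
Qed.

Lemma SY_local_star_seq Y A : SY G Y A -> local_star_seq Y A.
Proof.
  intros H; apply H; [apply local_star_seq_closed|]; intros T HT.
  destruct (BDO_local_star T HT) as [HB [L L']].
  pose proof HB as HB'; rewrite bounded_iff in HB'; destruct HB' as [M HM].
  split; [|split].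
  - assert (HP : forall n, bounded_by (opcomp G (proj (Y n)) (opcomp G T (proj (Y n)))) (1 * (M * 1)))
      by (intros; repeat apply bounded_by_comp; auto using bounded_by_proj).
    split; [|exists (1 * (M * 1)); intros n; apply (HP n)].
    intros n; split; [|eapply bounded_by_bounded, HP].
    intros x Hx t; unfold opcomp; rewrite !proj_proj; reflexivity.
  - apply local_seq_compress, L.
  - eapply local_seq_ext; [|apply local_seq_compress, L'].
    intros n y; symmetry; apply adj_compress_delta, HB.
Qed.

(** * Approximation of a sequence by its strong limit *)

Definition approximates Y A T : Prop :=
  forall e, 0 < e -> exists F, forall k y, inside F y (Y k) ->
    vnorm_le (vsub (A k (delta y)) (T (delta y))) e.

Definition exhausting Y : Prop :=
  forall F y, exists N, forall k, (N <= k)%nat -> inside F y (Y k).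

Lemma exhausting_of_union Y :
  (forall n t, Y n t -> Y (S n) t) -> (forall t, exists n, Y n t) -> exhausting Y.
Proof.
  intros Hinc Hun F y.
  destruct (eventually_forall_list F (fun k f => Y k (gmul f y))) as [N HN].
  - intros f _; destruct (Hun (gmul f y)) as [N HN]; exists N; intros n Hn.
    induction Hn; auto.
  - exists N; exact HN.
Qed.

(** One combination L is close to A_k delta_y for every admissible k, hence also to the
    coordinatewise limit T delta_y. Comparing both with L removes any dependence of k on y beyond F
    y inside Y k. *)
Lemma approximates_of_local Y A T : exhausting Y -> local_seq Y A ->
  (forall y t e, 0 < e -> exists N, forall n, (N <= n)%nat ->
     Cabs (Csub (A n (delta y) t) (T (delta y) t)) <= e) ->
  approximates Y A T.
Proof.
  intros HY HL Hlim e He; destruct (HL (e / 2)) as [F [K [_ H]]]; [lra|].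
  exists F; intros k y Hk; destruct (H y) as [L [_ [_ E]]].
  replace e with (e / 2 + e / 2) by field; eapply vnorm_le_sub_trans; [apply E, Hk|].
  apply vnorm_le_sub_sym, vnorm_le_lim with (fun n => vsub (A n (delta y)) (comb L y)).
  - intros t d Hd; destruct (Hlim y t d Hd) as [N HN]; exists N; intros n Hn; specialize (HN n Hn).
    unfold Defs.vsub.
    match goal with |- Cabs ?c <= _ =>
      replace c with (Csub (A n (delta y) t) (T (delta y) t)) by ring end; exact HN.
  - destruct (HY F y) as [N HN]; exists N; intros n Hn; apply E, HN, Hn.
Qed.

(** Strong convergence of the adjoints is not given, but their matrix entries are conjugates of
    those of A_n and so converge. Coordinatewise convergence together with locality is all that
    [approximates_of_local] requires. *)
Lemma SY_approximates Y A T : exhausting Y -> SY G Y A ->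
  Defs.strong_lim G (fun n => opcomp G (A n) (proj (Y n))) T ->
  approximates Y A T /\ approximates Y (fun n => adj (A n)) (adj T).
Proof.
  intros HY HA HT; destruct (SY_local_star_seq Y A HA) as [[HB _] [L L']].
  assert (Hp : forall y t e, 0 < e -> exists N, forall n, (N <= n)%nat ->
     Cabs (Csub (A n (delta y) t) (T (delta y) t)) <= e).
  { intros y t e He; destruct (strong_lim_coord _ _ (delta y) t e HT (l2_delta y) He) as [N HN].
    exists N; intros n Hn; specialize (HN n Hn); unfold opcomp in HN.
    rewrite compressed_comp_proj in HN by (try apply HB; apply l2_delta); exact HN. }
  split; apply approximates_of_local; auto.
  intros y t e He; destruct (Hp t y e He) as [N HN]; exists N; intros n Hn; specialize (HN n Hn).
  rewrite !adj_delta, <- Cconj_sub, Cabs_conj; exact HN.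
Qed.

End Locality.

(** * Block operators and their shifts *)

Section Groups.
Context {G : group}.
Implicit Types a b : G.

Lemma gmul_assoc_r a b c : @gmul G (gmul a b) c = gmul a (gmul b c).
Proof. symmetry; apply gmulA. Qed.

Lemma gmulK_l a b : gmul (ginv a) (gmul a b) = b.
Proof. rewrite gmulA, gmulVl, gmul1l; reflexivity. Qed.

Lemma gmulK_r a b : gmul a (gmul (ginv a) b) = b.
Proof. rewrite gmulA, gmulVr, gmul1l; reflexivity. Qed.

Lemma ginv_ginv a : ginv (ginv a) = a.
Proof. apply (gmul_cancel_l _ _ (ginv a)); rewrite gmulVr, gmulVl; reflexivity. Qed.

Lemma ginv_mul a b : ginv (gmul a b) = gmul (ginv b) (ginv a).
Proof.
  apply (gmul_cancel_l _ _ (gmul a b)).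
  rewrite gmulVr, gmul_assoc_r, gmulK_r, gmulVr; reflexivity.
Qed.

Lemma ginv_one : ginv (@gone G) = gone.
Proof. rewrite <- (gmul1l _ (ginv gone)); apply gmulVr. Qed.
End Groups.

Global Hint Rewrite @gmul_assoc_r @gmulK_l @gmulK_r @ginv_ginv @ginv_mul @ginv_one
  gmul1l gmul1r gmulVl gmulVr : grp.
Ltac grp := autorewrite with grp; try reflexivity.

Section Shifts.
Context {G : group}.
Implicit Types (x : vec G) (s t : G) (T S : op G).
Local Notation vadd := (Defs.vadd G).
Local Notation vzero := (Defs.vzero G).
Local Notation vnorm_le := (Defs.vnorm_le G).
Local Notation l2 := (Defs.l2 G).
Local Notation proj := (Defs.proj G).
Local Notation strong_lim := (Defs.strong_lim G).
Local Notation is_adjoint := (Defs.is_adjoint G).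

Definition conjop h T : op G := opcomp G (RopInv G h) (opcomp G T (Rop G h)).

Lemma Rop_delta h s : Rop G h (delta s) = delta (gmul s (ginv h)).
Proof.
  apply vec_ext; intros t; unfold Rop, delta.
  destruct (dec (gmul t h = s)) as [i|i]; destruct (dec (t = gmul s (ginv h))) as [j|j];
    try reflexivity; exfalso.
  - apply j; rewrite <- i; grp.
  - apply i; rewrite j; grp.
Qed.

Lemma RopInv_delta h s : RopInv G h (delta s) = delta (gmul s h).
Proof. unfold RopInv; rewrite Rop_delta; grp. Qed.

Lemma Rop_Rop g h x : Rop G g (Rop G h x) = Rop G (gmul g h) x.
Proof. apply vec_ext; intros t; unfold Rop; grp. Qed.

Lemma conjop_delta h T s : conjop h T (delta s) = RopInv G h (T (delta (gmul s (ginv h)))).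
Proof. unfold conjop, opcomp; rewrite Rop_delta; reflexivity. Qed.

Lemma l2_Rop h x : l2 x -> l2 (Rop G h x).
Proof. intros [r H]; exists (1 * r); apply (bounded_by_vnorm _ _ _ _ (bounded_by_Rop h) H). Qed.

Lemma vnorm_le_Rop h x r : vnorm_le x r -> vnorm_le (Rop G h x) r.
Proof.
  intros H; rewrite <- (Rmult_1_l r); apply (bounded_by_vnorm _ _ _ _ (bounded_by_Rop h) H).
Qed.

Lemma conjop_bounded_by h T M : bounded_by T M -> bounded_by (conjop h T) M.
Proof.
  intros H; replace M with (1 * (M * 1)) by ring.
  repeat apply bounded_by_comp; auto using bounded_by_Rop, bounded_by_RopInv.
Qed.

Lemma conjop_bounded h T : bounded G T -> bounded G (conjop h T).
Proof. rewrite !bounded_iff; intros [M H]; exists M; apply conjop_bounded_by, H. Qed.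

Lemma is_adjoint_op_eq T S S' : op_eq G S S' -> is_adjoint T S -> is_adjoint T S'.
Proof.
  intros E H x y Hx Hy; destruct (H x y Hx Hy) as [c Hc]; exists c.
  replace (S' y) with (S y); [exact Hc|apply vec_ext, E, Hy].
Qed.

Lemma Rop_adjoint h : is_adjoint (Rop G h) (RopInv G h).
Proof.
  apply is_adjoint_op_eq with (adj (Rop G h)).
  - intros y Hy t; unfold adj; rewrite Rop_delta, (ip_eq _ _ _ (inner_delta_l _ y)), Cconj_conj.
    reflexivity.
  - apply adj_is_adjoint, (bounded_by_bounded _ _ (bounded_by_Rop h)).
Qed.

Lemma RopInv_adjoint h : is_adjoint (RopInv G h) (Rop G h).
Proof. apply is_adjoint_sym, Rop_adjoint. Qed.

Lemma conjop_adjoint h T S : (forall x, l2 x -> l2 (T x)) -> (forall x, l2 x -> l2 (S x)) ->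
  is_adjoint T S -> is_adjoint (conjop h T) (conjop h S).
Proof.
  intros HT HS H; unfold conjop.
  change (opcomp G (RopInv G h) (opcomp G S (Rop G h)))
    with (opcomp G (opcomp G (RopInv G h) S) (Rop G h)).
  apply is_adjoint_comp; [| |apply RopInv_adjoint|].
  - intros x Hx; apply HT, l2_Rop, Hx.
  - intros x Hx; apply l2_Rop, Hx.
  - apply is_adjoint_comp; auto using Rop_adjoint.
    intros x Hx; apply l2_Rop, Hx.
Qed.

Lemma adj_conjop h T : bounded G T -> op_eq G (adj (conjop h T)) (conjop h (adj T)).
Proof.
  intros HT x Hx t; symmetry; revert x Hx t; apply is_adjoint_eq_adj, conjop_adjoint.
  - intros; apply bounded_l2; assumption.
  - intros; apply bounded_l2; auto using adj_bounded.
  - apply adj_is_adjoint, HT.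
Qed.

Definition has_limop T (h : nat -> G) T' : Prop :=
  tends_to_infinity G h /\ bounded G T' /\
  strong_lim (fun m => conjop (h m) T) T' /\
  strong_lim (fun m => conjop (h m) (adj T)) (adj T').

(** Uniqueness of adjoints on l2 lets the existential witnesses be replaced by [adj T] and
    [adj T']. *)
Lemma is_limop_iff T h T' : bounded G T -> (is_limop G T h T' <-> has_limop T h T').
Proof.
  intros HT; split.
  - intros [Hh [HT' [HS [B [B' [HB [HBa [HB' [HBa' HS']]]]]]]]].
    split; [exact Hh|split; [exact HT'|split; [exact HS|]]].
    apply strong_lim_op_eq with B'; [apply is_adjoint_eq_adj, HBa'|].
    intros x Hx e He; destruct (HS' x Hx e He) as [N HN]; exists N; intros n Hn.
    replace (conjop (h n) (adj T) x) with (opcomp G (RopInv G (h n)) (opcomp G B (Rop G (h n))) x);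
      [apply HN, Hn|].
    unfold conjop, opcomp; f_equal; apply vec_ext, is_adjoint_eq_adj; [exact HBa|apply l2_Rop, Hx].
  - intros [Hh [HT' [HS HS']]]; split; [exact Hh|split; [exact HT'|split; [exact HS|]]].
    exists (adj T), (adj T'); auto 10 using adj_bounded, adj_is_adjoint.
Qed.

Lemma has_limop_subseq T h T' (phi : nat -> nat) :
  (forall j, (j <= phi j)%nat) -> has_limop T h T' -> has_limop T (fun j => h (phi j)) T'.
Proof.
  intros Hphi [Hh [HT' [HS HS']]]; split; [|split; [exact HT'|split]].
  - intros l; destruct (Hh l) as [N HN]; exists N; intros n Hn; apply HN; specialize (Hphi n); lia.
  - apply (strong_lim_subseq (fun m => conjop (h m) T)); assumption.
  - apply (strong_lim_subseq (fun m => conjop (h m) (adj T))); assumption.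
Qed.

Lemma proj_adjoint P : is_adjoint (proj P) (proj P).
Proof.
  intros x y Hx Hy; exists (ip (proj P x) y).
  pose proof (ip_inner (proj P x) y (l2_proj P x Hx) Hy) as H; split; [exact H|].
  revert H; unfold inner; intros H.
  replace (fun t => Cmul (x t) (Cconj (proj P y t)))
    with (fun t => Cmul (proj P x t) (Cconj (y t))); [exact H|].
  apply functional_extensionality; intros t; unfold Defs.proj.
  destruct (dec (P t)); [|rewrite Cconj_0]; ring.
Qed.

Lemma conjop_proj_delta h P s :
  conjop h (proj P) (delta s) = if dec (P (gmul s (ginv h))) then delta s else vzero.
Proof.
  rewrite conjop_delta; destruct (dec _) as [i|i].
  - rewrite proj_delta, RopInv_delta by exact i; grp.
  - rewrite proj_delta_out by exact i; reflexivity.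
Qed.

(** Pythagoras for norm bounds instead of norms: r1 is the exact norm of the part on U, and r2
    absorbs whatever r leaves. *)
Lemma split_norm (U : G -> Prop) x r : vnorm_le x r ->
  exists r1 r2, vnorm_le (proj U x) r1 /\ vnorm_le (proj (fun t => ~ U t) x) r2 /\
    r1 * r1 + r2 * r2 = r * r.
Proof.
  intros Hx.
  set (f := fun t => Cnorm2 (proj U x t)); set (g := fun t => Cnorm2 (proj (fun t => ~ U t) x t)).
  assert (Hf : forall t, 0 <= f t) by (intros; apply Cnorm2_pos).
  assert (Hg : forall t, 0 <= g t) by (intros; apply Cnorm2_pos).
  assert (Hfg : forall l1 l2, NoDup l1 -> NoDup l2 -> lsum G f l1 + lsum G g l2 <= r * r).
  { intros l1 l2 H1 H2; destruct (nodup_union l1 l2) as [l [Hl [Hi1 [Hi2 _]]]].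
    pose proof (lsum_incl f _ _ Hf H1 Hi1); pose proof (lsum_incl g _ _ Hg H2 Hi2).
    destruct Hx as [_ Hx]; specialize (Hx l Hl).
    assert (lsum G f l + lsum G g l <= lsum G (fun t => Cnorm2 (x t)) l); [|lra].
    rewrite <- lsum_add; apply lsum_le; intros t; unfold f, g, Defs.proj.
    destruct (dec (U t)); destruct (dec (~ U t)); try tauto; unfold Cnorm2; simpl; lra. }
  destruct (has_sumR_nonneg f (r * r)) as [a [_ [Ha H1]]]; [exact Hf| |].
  { intros l Hl; specialize (Hfg l [] Hl (NoDup_nil _)); simpl in Hfg; lra. }
  assert (Ha0 : 0 <= a) by exact (H1 [] (NoDup_nil _)).
  assert (H2 : forall l, NoDup l -> lsum G g l <= r * r - a).
  { intros l Hl; assert (a <= r * r - lsum G g l); [|lra].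
    apply Ha; intros l' Hl'; specialize (Hfg l' l Hl' Hl); lra. }
  assert (a <= r * r) by (specialize (H2 [] (NoDup_nil _)); simpl in H2; lra).
  exists (sqrt a), (sqrt (r * r - a)); rewrite !sqrt_sqrt by lra; split; [|split; [|lra]];
    (split; [apply sqrt_pos|]); intros l Hl; rewrite sqrt_sqrt by lra; auto.
Qed.

(** The converse half of Pythagoras: at each point at most one of the two vectors is nonzero, so
    squared norms add. *)
Lemma join_norm (U : G -> Prop) x y r1 r2 r : 0 <= r -> r1 * r1 + r2 * r2 = r * r ->
  (forall t, ~ U t -> x t = C0) -> (forall t, U t -> y t = C0) ->
  vnorm_le x r1 -> vnorm_le y r2 -> vnorm_le (vadd x y) r.
Proof.
  intros Hr E Hx Hy [_ H1] [_ H2]; split; [exact Hr|]; intros l Hl.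
  specialize (H1 l Hl); specialize (H2 l Hl).
  assert (lsum G (fun t => Cnorm2 (vadd x y t)) l <=
    lsum G (fun t => Cnorm2 (x t)) l + lsum G (fun t => Cnorm2 (y t)) l); [|lra].
  rewrite <- lsum_add; apply lsum_le; intros t; unfold Defs.vadd.
  destruct (dec (U t)) as [i|i]; [rewrite (Hy t i)|rewrite (Hx t i)]; unfold Cnorm2; simpl; lra.
Qed.

End Shifts.

(** * The assembled operator and its blocks *)

Section Blocks.
Context {G : group}.
Variables (Y : nat -> G -> Prop) (v : nat -> G).
Implicit Types (x : vec G) (s t : G) (T B : op G) (A : nat -> op G).
Local Notation vadd := (Defs.vadd G).
Local Notation vsub := (Defs.vsub G).
Local Notation vzero := (Defs.vzero G).
Local Notation vnorm_le := (Defs.vnorm_le G).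
Local Notation l2 := (Defs.l2 G).
Local Notation proj := (Defs.proj G).
Local Notation strong_lim := (Defs.strong_lim G).
Hypothesis Hdisj : forall m n t, Y m (gmul t (v m)) -> Y n (gmul t (v n)) -> m = n.

(** The n-th summand of Op(A). It lives on the set Y_n v_n^-1, membership of t in which is written
    [Y n (gmul t (v n))] throughout. *)
Definition block A n : op G :=
  opcomp G (Rop G (v n)) (opcomp G (A n) (opcomp G (proj (Y n)) (RopInv G (v n)))).

Lemma block_bounded_by A M n : bounded_by (A n) M -> bounded_by (block A n) M.
Proof.
  intros H; replace M with (1 * (M * (1 * 1))) by ring.
  repeat apply bounded_by_comp;
    auto using bounded_by_Rop, bounded_by_RopInv, bounded_by_proj.
Qed.

Lemma block_out A n x t : compressed G (Y n) (A n) -> l2 x ->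
  ~ Y n (gmul t (v n)) -> block A n x t = C0.
Proof.
  intros HA Hx Ht; unfold block, opcomp, Rop at 1; apply compressed_out with (Y n); auto.
  apply l2_proj, l2_Rop, Hx.
Qed.

Lemma block_proj A n x (P : G -> Prop) :
  (forall t, Y n (gmul t (v n)) -> P t) -> block A n (proj P x) = block A n x.
Proof.
  intros HP; unfold block, opcomp; do 2 f_equal; apply vec_ext; intros t.
  unfold Defs.proj at 1 3; destruct (dec (Y n t)) as [i|i]; [|reflexivity].
  unfold RopInv, Rop, Defs.proj; destruct (dec (P (gmul t (ginv (v n))))) as [j|j]; [reflexivity|].
  elim j; apply HP; grp; exact i.
Qed.

Lemma block_delta A n s : compressed G (Y n) (A n) -> block A n (delta s) =
  Rop G (v n) (A n (delta (gmul s (v n)))).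
Proof.
  intros HA; unfold block, opcomp; rewrite RopInv_delta.
  rewrite compressed_comp_proj by auto using l2_delta; reflexivity.
Qed.

(** The bound does not grow with N, because the blocks act between mutually orthogonal subspaces and
    the norm of a direct sum is the largest norm of a summand. *)
Lemma op_partial_bounded_by A M N : 0 <= M ->
  (forall n, compressed G (Y n) (A n)) -> (forall n, bounded_by (A n) M) ->
  bounded_by (op_partial G Y v A N) M.
Proof.
  intros HM0 HA HM.
  (* U N is the union of the first N blocks. The induction also needs that the partial sum takes
     values on U N and sees only the part of x on U N. *)
  set (U := fun N t => exists n, (n < N)%nat /\ Y n (gmul t (v n))).
  assert (H : bounded_by (op_partial G Y v A N) M /\
    (forall x t, l2 x -> ~ U N t -> op_partial G Y v A N x t = C0) /\
    (forall x, l2 x -> op_partial G Y v A N (proj (U N) x) = op_partial G Y v A N x));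
    [|apply H].
  induction N as [|N [IH1 [IH2 IH3]]].
  - split; [apply bounded_by_weaken with 0; [exact HM0|apply bounded_by_zero]|].
    split; intros; reflexivity.
  - pose proof (block_bounded_by A M N (HM N)) as HB.
    change (op_partial G Y v A (S N)) with (opadd G (op_partial G Y v A N) (block A N)).
    assert (HU : forall t, U (S N) t <-> U N t \/ Y N (gmul t (v N))).
    { intros t; split.
      - intros [n [Hn Ht]]; destruct (Nat.eq_dec n N) as [->|]; [right; exact Ht|].
        left; exists n; split; [lia|exact Ht].
      - intros [[n [Hn Ht]]|Ht]; [exists n|exists N]; split; auto; lia. }
    assert (HUN : forall t, U N t -> ~ Y N (gmul t (v N))).
    { intros t [n [Hn Ht]] Ht'; specialize (Hdisj _ _ _ Ht Ht'); lia. }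
    split; [|split].
    + split; [apply (bounded_by_add _ _ _ _ IH1 HB)|split; [exact HM0|]].
      intros x r Hx; pose proof (vnorm_le_pos _ _ Hx) as Hr.
      assert (Hl2 : l2 x) by (exists r; exact Hx).
      destruct (split_norm (U N) x r Hx) as [r1 [r2 [H1 [H2 E]]]].
      unfold opadd; apply join_norm with (U N) (M * r1) (M * r2).
      * apply Rmult_le_pos; assumption.
      * replace (M * r * (M * r)) with (M * M * (r * r)) by ring; rewrite <- E; ring.
      * intros t Ht; apply IH2; assumption.
      * intros t Ht; apply block_out; auto.
      * rewrite <- IH3 by exact Hl2; apply (bounded_by_vnorm _ _ _ _ IH1 H1).
      * rewrite <- (block_proj A N x (fun t => ~ U N t)).
        -- apply (bounded_by_vnorm _ _ _ _ HB H2).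
        -- intros t Ht Ht'; exact (HUN t Ht' Ht).
    + intros x t Hx Ht; rewrite HU in Ht; unfold opadd, Defs.vadd.
      rewrite IH2, block_out by (auto; tauto); ring.
    + intros x Hx; unfold opadd; f_equal.
      * rewrite <- (IH3 x Hx), <- (IH3 (proj (U (S N)) x)) by auto using l2_proj.
        f_equal; apply vec_ext; intros t; unfold Defs.proj.
        destruct (dec (U N t)) as [i|i]; [|reflexivity].
        destruct (dec (U (S N) t)) as [j|j]; [reflexivity|]; elim j; apply HU; left; exact i.
      * apply block_proj; intros t Ht; apply HU; right; exact Ht.
Qed.

Lemma op_partial_delta_out A N s : (forall n, bounded G (A n)) ->
  (forall n, (n < N)%nat -> ~ Y n (gmul s (v n))) -> op_partial G Y v A N (delta s) = vzero.
Proof.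
  intros HA; induction N as [|N IH]; intros H; [reflexivity|].
  change (vadd (op_partial G Y v A N (delta s)) (block A N (delta s)) = vzero).
  rewrite IH by (intros; apply H; lia).
  unfold block, opcomp; rewrite RopInv_delta, proj_delta_out by (apply H; lia).
  rewrite (linear_zero (A N)) by apply HA; apply vec_ext; intros t.
  unfold Defs.vadd, Rop, Defs.vzero; ring.
Qed.

Lemma op_partial_delta A N n s : (forall n, bounded G (A n)) ->
  (forall n, compressed G (Y n) (A n)) ->
  Y n (gmul s (v n)) -> (n < N)%nat ->
  op_partial G Y v A N (delta s) = Rop G (v n) (A n (delta (gmul s (v n)))).
Proof.
  intros HA HC Hn HN; rewrite <- block_delta by auto.
  assert (Hz : forall u : vec G, vadd vzero u = u)
    by (intros; apply vec_ext; intros; unfold Defs.vadd, Defs.vzero; ring).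
  assert (Hz' : forall u : vec G, vadd u vzero = u)
    by (intros; apply vec_ext; intros; unfold Defs.vadd, Defs.vzero; ring).
  induction HN as [|N HN IH].
  - change (vadd (op_partial G Y v A n (delta s)) (block A n (delta s)) = block A n (delta s)).
    rewrite op_partial_delta_out, Hz; auto.
    intros m Hm Hm'; specialize (Hdisj _ _ _ Hm' Hn); lia.
  - change (vadd (op_partial G Y v A N (delta s)) (block A N (delta s)) = block A n (delta s)).
    rewrite IH; unfold block at 2, opcomp; rewrite RopInv_delta, proj_delta_out.
    + rewrite (linear_zero (A N)) by apply HA; apply Hz'.
    + intros H; specialize (Hdisj _ _ _ H Hn); lia.
Qed.

(** Op(A) plus the projection onto Gamma', described by its columns. The later arguments use B only
    through this and its boundedness, and the description is stable under adjoints. *)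
Definition assembled A B : Prop := forall s,
  (forall n, Y n (gmul s (v n)) -> B (delta s) = Rop G (v n) (A n (delta (gmul s (v n))))) /\
  ((forall n, ~ Y n (gmul s (v n))) -> B (delta s) = delta s).

Lemma GammaPrime_iff t : GammaPrime G Y v t <-> forall n, ~ Y n (gmul t (v n)).
Proof.
  split.
  - intros H n Hn; apply H; exists n, (gmul t (v n)); split; [exact Hn|grp].
  - intros H [n [y [Hy ->]]]; apply (H n); grp; exact Hy.
Qed.

Lemma strong_lim_const_at (T : nat -> op G) S x u N : strong_lim T S -> l2 x ->
  (forall n, (N <= n)%nat -> T n x = u) -> S x = u.
Proof.
  intros H Hx E; apply vec_ext; intros t; apply C_eq_of_close; intros e He.
  destruct (strong_lim_coord T S x t e H Hx He) as [N' HN'].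
  specialize (HN' (Nat.max N N') ltac:(lia)); rewrite E in HN' by lia.
  rewrite Cabs_sub_sym; exact HN'.
Qed.

(** At most one block contains a given s, so the partial sums applied to delta_s become constant and
    their limit can be read off. *)
Lemma assembled_strong_lim A T : bseq G Y A -> strong_lim (op_partial G Y v A) T ->
  bounded G (opadd G T (proj (GammaPrime G Y v))) /\
  assembled A (opadd G T (proj (GammaPrime G Y v))).
Proof.
  intros HA HT; destruct (bseq_bounded_by Y A HA) as [M [HM0 HM]]; split.
  - apply bounded_by_bounded with (M + 1), bounded_by_add; [|apply bounded_by_proj].
    apply strong_lim_bounded_by with (op_partial G Y v A); [|exact HT].
    intros N; apply op_partial_bounded_by; auto; intros n; apply HA.
  - intros s; split.
    + intros n Hn; unfold opadd.
      rewrite (strong_lim_const_at _ _ (delta s)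
        (Rop G (v n) (A n (delta (gmul s (v n))))) (S n) HT (l2_delta s))
        by (intros N HN; apply op_partial_delta; auto; intros k; apply HA).
      rewrite proj_delta_out; [apply vec_ext; intros t; unfold Defs.vadd, Defs.vzero; ring|].
      rewrite GammaPrime_iff; intros H; exact (H n Hn).
    + intros Hs; unfold opadd.
      rewrite (strong_lim_const_at _ _ (delta s) vzero 0 HT (l2_delta s))
        by (intros N HN; apply op_partial_delta_out; auto; intros k; apply HA).
      rewrite proj_delta by (apply GammaPrime_iff, Hs).
      apply vec_ext; intros t; unfold Defs.vadd, Defs.vzero; ring.
Qed.

(** Entries of B between distinct blocks, or between a block and its outside, vanish; transposing
    and conjugating therefore respects the blocks. It lets the arguments for B be repeated for
    [adj B]. *)
Lemma assembled_adj A B : bseq G Y A -> assembled A B -> assembled (fun n => adj (A n)) (adj B).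
Proof.
  intros HA HB s.
  assert (Hout : forall n t u, ~ Y n t -> A n (delta u) t = C0)
    by (intros n t u Ht; apply compressed_out with (Y n); auto using l2_delta; apply HA).
  assert (Hin : forall n t u, ~ Y n u -> A n (delta u) t = C0).
  { intros n t u Hu; rewrite <- (compressed_comp_proj (Y n)) by (auto using l2_delta; apply HA).
    rewrite proj_delta_out, (linear_zero (A n)) by (auto; apply HA); reflexivity. }
  assert (Hne : forall t, s <> t -> (delta t : vec G) s = C0)
    by (intros t Ht; unfold delta; destruct (dec (s = t)); tauto).
  split.
  - intros n Hn; apply vec_ext; intros t; rewrite adj_delta; unfold Rop at 1; rewrite adj_delta.
    f_equal; destruct (dec (Y n (gmul t (v n)))) as [Ht|Ht].
    + rewrite (proj1 (HB t) n Ht); reflexivity.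
    + rewrite (Hin n _ _ Ht); destruct (dec (exists m, Y m (gmul t (v m)))) as [[m Hm]|Hm].
      * rewrite (proj1 (HB t) m Hm); unfold Rop; apply Hout; intros H.
        rewrite (Hdisj _ _ _ H Hn) in Hm; contradiction.
      * rewrite (proj2 (HB t)) by (intros m Hm'; apply Hm; exists m; exact Hm').
        apply Hne; intros <-; contradiction.
  - intros Hs; apply vec_ext; intros t; rewrite adj_delta.
    destruct (dec (exists m, Y m (gmul t (v m)))) as [[m Hm]|Hm].
    + rewrite (proj1 (HB t) m Hm); unfold Rop; rewrite Hout by apply Hs.
      unfold delta; destruct (dec (t = s)) as [->|]; [elim (Hs m Hm)|apply Cconj_0].
    + rewrite (proj2 (HB t)) by (intros m Hm'; apply Hm; exists m; exact Hm').
      unfold delta; destruct (dec (s = t)) as [->|]; destruct (dec (t = _)); try congruence;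
        [apply Cconj_1|apply Cconj_0].
Qed.

(* Along [h m = v (k m) (g m)] the block number [k m] is moved to the set
   [Y (k m) (g m)], which swallows every finite set, so only that block matters. *)
Lemma shifted_block_close A B T (k : nat -> nat) (g : nat -> G) :
  assembled A B -> approximates Y A T ->
  (forall F, exists N, forall m, (N <= m)%nat -> inside F (ginv (g m)) (Y (k m))) ->
  forall s e, 0 < e -> exists N, forall m, (N <= m)%nat ->
    vnorm_le (vsub (conjop (gmul (v (k m)) (g m)) B (delta s)) (conjop (g m) T (delta s))) e.
Proof.
  intros HB HA Hg s e He; destruct (HA e He) as [F HF].
  destruct (Hg (s :: map (fun f => gmul f s) F)) as [N HN]; exists N; intros m Hm.
  specialize (HN m Hm).
  assert (Hs : Y (k m) (gmul s (ginv (g m)))) by (apply HN; left; reflexivity).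
  assert (Hs' : inside F (gmul s (ginv (g m))) (Y (k m))).
  { intros f Hf; rewrite gmulA; apply HN; right; apply in_map_iff; exists f; auto. }
  specialize (HF (k m) _ Hs'); rewrite !conjop_delta.
  assert (E : gmul (gmul s (ginv (gmul (v (k m)) (g m)))) (v (k m)) = gmul s (ginv (g m))) by grp.
  rewrite (proj1 (HB _) (k m)) by (rewrite E; exact Hs).
  rewrite E; unfold RopInv; rewrite Rop_Rop, ginv_mul, gmul_assoc_r, gmulVl, gmul1r.
  exact (vnorm_le_Rop (ginv (g m)) _ e HF).
Qed.

(** The two shifted operators differ by a null sequence on every basis vector and are uniformly
    bounded. Both directions are needed: one identifies limit operators of B, the other produces
    them. *)
Lemma strong_lim_shifted_block A B T T' (k : nat -> nat) (g : nat -> G) :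
  bounded G B -> bounded G T -> assembled A B -> approximates Y A T ->
  (forall F, exists N, forall m, (N <= m)%nat -> inside F (ginv (g m)) (Y (k m))) ->
  (strong_lim (fun m => conjop (gmul (v (k m)) (g m)) B) T' <->
   strong_lim (fun m => conjop (g m) T) T').
Proof.
  intros HB HT HAB HAT Hg; rewrite bounded_iff in HB, HT.
  destruct HB as [M HM]; destruct HT as [N HN].
  assert (HM' : forall m, bounded_by (conjop (gmul (v (k m)) (g m)) B) (Rmax M N))
    by (intros; apply conjop_bounded_by, (bounded_by_weaken _ M); auto using Rmax_l).
  assert (HN' : forall m, bounded_by (conjop (g m) T) (Rmax M N))
    by (intros; apply conjop_bounded_by, (bounded_by_weaken _ N); auto using Rmax_r).
  pose proof (shifted_block_close A B T k g HAB HAT Hg) as Hc.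
  split; intros H; eapply strong_lim_transfer; try exact H; try exact HM'; try exact HN'.
  - intros s e He; destruct (Hc s e He) as [K HK]; exists K; intros m Hm.
    apply vnorm_le_sub_sym, HK, Hm.
  - exact Hc.
Qed.

End Blocks.

(** * Subsequences *)

Lemma not_eventually (P : nat -> Prop) :
  ~ (exists N, forall n, (N <= n)%nat -> P n) -> forall N, exists n, (N <= n)%nat /\ ~ P n.
Proof.
  intros H N; apply NNPP; intros H'; apply H; exists N; intros n Hn.
  apply NNPP; intros H''; apply H'; exists n; auto.
Qed.

Lemma pigeonhole {I : Type} (l : list I) (P : I -> nat -> Prop) :
  (forall N, exists n, (N <= n)%nat /\ exists i, In i l /\ P i n) ->
  exists i, In i l /\ forall N, exists n, (N <= n)%nat /\ P i n.
Proof.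
  intros H; apply NNPP; intros Hn.
  destruct (eventually_forall_list l (fun n i => ~ P i n)) as [N HN].
  - intros i Hi; apply NNPP; intros Hi'; apply Hn; exists i; split; [exact Hi|]; intros N.
    destruct (not_eventually _ Hi' N) as [n [H1 H2]]; exists n; split; [exact H1|apply NNPP, H2].
  - destruct (H N) as [n [H1 [i [Hi HP]]]]; exact (HN n H1 i Hi HP).
Qed.

Lemma increasing_ge (phi : nat -> nat) :
  (forall j, (phi j < phi (S j))%nat) -> forall j, (j <= phi j)%nat.
Proof. intros H j; induction j as [|j IH]; [lia|]; specialize (H j); lia. Qed.

Lemma increasing_comp (phi psi : nat -> nat) :
  (forall j, (phi j < phi (S j))%nat) -> (forall j, (psi j < psi (S j))%nat) ->
  forall j, (phi (psi j) < phi (psi (S j)))%nat.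
Proof.
  intros H H' j; specialize (H' j); induction H' as [|m _ IH]; [apply H|].
  specialize (H m); lia.
Qed.

Lemma joint_subsequence (P : nat -> nat -> nat -> Prop) :
  (forall j N, exists m k, (N <= m)%nat /\ (N <= k)%nat /\ P j m k) ->
  exists phi kappa : nat -> nat, (forall j, (phi j < phi (S j))%nat) /\
    (forall j, (kappa j < kappa (S j))%nat) /\ (forall j, (1 <= kappa j)%nat) /\
    forall j, P j (phi j) (kappa j).
Proof.
  intros H.
  assert (H' : forall q : nat * nat, exists p : nat * nat,
    (fst q <= fst p)%nat /\ (fst q <= snd p)%nat /\ P (snd q) (fst p) (snd p)).
  { intros [N j]; destruct (H j N) as [m [k Hk]]; exists (m, k); exact Hk. }
  apply choice in H'; destruct H' as [next Hnext].
  (* Each call asks for both indices to exceed the two chosen before. Starting from the bound 1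
     makes all values of kappa positive. *)
  set (w := fix w j := match j with
    | O => next (1%nat, O)
    | S i => next (S (Nat.max (fst (w i)) (snd (w i))), S i) end).
  exists (fun j => fst (w j)), (fun j => snd (w j)).
  assert (Hw : forall j, (fst (w j) < fst (w (S j)))%nat /\ (snd (w j) < snd (w (S j)))%nat).
  { intros j; destruct (Hnext (S (Nat.max (fst (w j)) (snd (w j))), S j)) as [H1 [H2 _]].
    change (next (S (Nat.max (fst (w j)) (snd (w j))), S j)) with (w (S j)) in H1, H2.
    cbn [fst] in H1, H2; lia. }
  split; [intros j; apply Hw|split; [intros j; apply Hw|split]].
  - intros [|j]; [apply (Hnext (1%nat, O))|].
    pose proof (Hw j); lia.
  - intros [|j]; [apply (Hnext (1%nat, O))|].
    apply (Hnext (S (Nat.max (fst (w j)) (snd (w j))), S j)).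
Qed.

Lemma subsequence_of (P : nat -> nat -> Prop) :
  (forall j N, exists m, (N <= m)%nat /\ P j m) ->
  exists phi : nat -> nat, (forall j, (phi j < phi (S j))%nat) /\ forall j, P j (phi j).
Proof.
  intros H; destruct (joint_subsequence (fun j m k => P j m)) as [phi [kappa [H1 [_ [_ H2]]]]].
  - intros j N; destruct (H j N) as [m [Hm HP]]; exists m, N; auto.
  - exists phi; auto.
Qed.

(** Sequential compactness of the space of subsets of a countable set, by Cantor's diagonal
    argument. *)
Lemma diagonal_subsequence (p : nat -> nat -> Prop) :
  exists phi : nat -> nat, (forall j, (phi j < phi (S j))%nat) /\
    forall i, (exists N, forall j, (N <= j)%nat -> p (phi j) i) \/
              (exists N, forall j, (N <= j)%nat -> ~ p (phi j) i).
Proof.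
  set (inf := fun J : nat -> Prop => forall N, exists n, (N <= n)%nat /\ J n).
  (* A decreasing chain of infinite index sets; on J (S i) the truth value of p at i is constant. *)
  set (J := fix J i := match i with
    | O => fun _ : nat => True
    | S i' => if dec (inf (fun n => J i' n /\ p n i'))
              then (fun n => J i' n /\ p n i') else (fun n => J i' n /\ ~ p n i') end).
  assert (HJ : forall i, inf (J i)).
  { induction i as [|i IH]; [intros N; exists N; split; [lia|exact I]|].
    simpl; destruct (dec (inf (fun n => J i n /\ p n i))) as [Hi|Hi]; [exact Hi|].
    intros N; apply NNPP; intros Hn; apply Hi; intros N'.
    destruct (IH (Nat.max N N')) as [n [H1 H2]]; exists n; split; [lia|split; [exact H2|]].
    apply NNPP; intros H3; apply Hn; exists n; split; [lia|split; assumption]. }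
  assert (HJS : forall i n, J (S i) n -> J i n).
  { intros i n; simpl; destruct (dec _); tauto. }
  assert (Hmono : forall i j, (i <= j)%nat -> forall n, J j n -> J i n).
  { intros i j Hij; induction Hij as [|j _ IH]; auto. }
  destruct (subsequence_of (fun j n => J j n)) as [phi [H1 H2]].
  - intros j N; apply HJ.
  - exists phi; split; [exact H1|]; intros i.
    assert (Hi : forall j, (S i <= j)%nat -> J (S i) (phi j)) by (intros j Hj; apply (Hmono _ j); auto).
    simpl in Hi; destruct (dec (inf (fun n => J i n /\ p n i))); [left|right];
      exists (S i); intros j Hj; apply Hi, Hj.
Qed.

(** * Geometry of the inflated blocks *)

Section Combinatorics.
Context {G : group}.
Variable Om : G -> Prop.
Variable Y : nat -> G -> Prop.
Variable v : nat -> G.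
Hypothesis Hgen : generates_semigroup G Om.
Hypothesis Hfin : forall n, finite_set G (Y n).
Hypothesis Hinfl : inflating G (Zset G Om Y) v.
Implicit Types s t : G.

Lemma OmegaN_one n : OmegaN G Om n gone.
Proof. exists []; split; [simpl; lia|split; [constructor|reflexivity]]. Qed.

Lemma OmegaN_eventually t : exists N, forall n, (N <= n)%nat -> OmegaN G Om n t.
Proof.
  destruct (Hgen t) as [l [_ [H1 H2]]]; exists (length l); intros n Hn; exists l; auto.
Qed.

(** Z_n contains Omega_n Y_n, with the identity as middle factor. Hence points within n steps of the
    n-th block belong to no other block. *)
Lemma Zset_mul n a y : OmegaN G Om n a -> Y n y -> Zset G Om Y n (gmul a y).
Proof.
  intros Ha Hy; exists a, gone, y; split; [right; exact Ha|split; [|split]].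
  - right; apply OmegaN_one.
  - left; exact Hy.
  - grp.
Qed.

Lemma Zset_Y n y : Y n y -> Zset G Om Y n y.
Proof. intros Hy; rewrite <- (gmul1l _ y); apply Zset_mul; [apply OmegaN_one|exact Hy]. Qed.

Lemma Zset_disjoint m n t :
  Zset G Om Y m (gmul t (v m)) -> Zset G Om Y n (gmul t (v n)) -> m = n.
Proof.
  intros Hm Hn; destruct (Nat.eq_dec m n) as [|H]; [assumption|].
  elim (Hinfl m n H t); split; [exists (gmul t (v m))|exists (gmul t (v n))]; split; auto; grp.
Qed.

Lemma Y_disjoint m n t : Y m (gmul t (v m)) -> Y n (gmul t (v n)) -> m = n.
Proof. intros Hm Hn; apply Zset_disjoint with t; apply Zset_Y; assumption. Qed.

Lemma tends_to_infinity_of_ne (h : nat -> G) :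
  (forall t, exists N, forall n, (N <= n)%nat -> h n <> t) -> tends_to_infinity G h.
Proof.
  intros H l; destruct (eventually_forall_list l (fun n t => h n <> t)) as [N HN]; [auto|].
  exists N; intros n Hn Hi; exact (HN n Hn _ Hi eq_refl).
Qed.

(** If v_{k m} g(m) = t, then t^-1 lies in the block of number k m. At most one block contains t^-1,
    and k m eventually exceeds its number. *)
Lemma shifted_tends_to_infinity (k : nat -> nat) (g : nat -> G) :
  (forall m, (m <= k m)%nat) ->
  (exists N, forall m, (N <= m)%nat -> Y (k m) (ginv (g m))) ->
  tends_to_infinity G (fun m => gmul (v (k m)) (g m)).
Proof.
  intros Hk [N HN]; apply tends_to_infinity_of_ne; intros t.
  destruct (dec (exists n, Y n (gmul (ginv t) (v n)))) as [[n0 Hn0]|Hn0].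
  - exists (Nat.max N (S n0)); intros m Hm <-; specialize (Hk m).
    assert (E : k m = n0); [|lia].
    eapply Y_disjoint; [|exact Hn0]; grp; apply HN; lia.
  - exists N; intros m Hm <-; apply Hn0; exists (k m); grp; apply HN, Hm.
Qed.

(* A finite union of blocks is finite, so a sequence tending to infinity that stays
   near the blocks visits blocks of arbitrarily large index. *)
Lemma large_block_index (h : nat -> G) f : tends_to_infinity G h ->
  (forall N, exists m, (N <= m)%nat /\ exists k, Y k (gmul (gmul f (ginv (h m))) (v k))) ->
  forall N, exists m k, (N <= m)%nat /\ (N <= k)%nat /\ Y k (gmul (gmul f (ginv (h m))) (v k)).
Proof.
  intros Hh H N.
  assert (Hl : forall N, exists l : list G, forall t k, (k < N)%nat ->
     Y k (gmul (gmul f (ginv t)) (v k)) -> In t l).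
  { clear N; intros N; induction N as [|N [l Hl]]; [exists []; intros; lia|].
    destruct (Hfin N) as [l' Hl'].
    exists (map (fun y => gmul (v N) (gmul (ginv y) f)) l' ++ l); intros t k Hk Ht; apply in_or_app.
    destruct (Nat.eq_dec k N) as [->|]; [left|right; apply Hl with k; [lia|exact Ht]].
    apply in_map_iff; exists (gmul (gmul f (ginv t)) (v N)); split; [grp|apply Hl', Ht]. }
  destruct (Hl N) as [l Hl']; destruct (Hh l) as [M HM].
  destruct (H (Nat.max N M)) as [m [Hm [k Hk]]]; exists m, k; split; [lia|split; [|exact Hk]].
  destruct (Nat.le_gt_cases N k) as [|Hlt]; [assumption|].
  elim (HM m); [lia|]; exact (Hl' _ k Hlt Hk).
Qed.

(** The displacements visited before the last step when the letters of l are applied one by one from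
    the left. As [gprod] applies the last letter first, these are the products of proper
    suffixes. *)
Fixpoint suffix_products (l : list G) : list G :=
  match l with [] => [] | _ :: l' => gprod G l' :: suffix_products l' end.

(** A walk that starts in X and ends outside has a point in X whose next step leaves X, hence a
    boundary point. Its displacement comes from a finite list depending on l alone, not on X or y,
    so the pigeonhole principle applies. *)
Lemma exit_point l X (y : G) : Forall Om l -> X y -> ~ X (gmul (gprod G l) y) ->
  exists w, In w (suffix_products l) /\ bd_Om G Om X (gmul w y).
Proof.
  induction l as [|o l IH]; intros HO Hy Hn.
  - elim Hn; simpl; rewrite gmul1l; exact Hy.
  - apply Forall_cons_iff in HO; destruct HO as [Ho HO].
    destruct (dec (X (gmul (gprod G l) y))) as [Hx|Hx].
    + exists (gprod G l); split; [left; reflexivity|]; split; [exact Hx|].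
      intros [_ Hi]; apply Hn; simpl; rewrite gmul_assoc_r; apply Hi, Ho.
    + destruct (IH HO Hy Hx) as [w [Hw Hb]]; exists w; split; [right; exact Hw|exact Hb].
Qed.

(** Multiplying s h_j^-1 by v_{k_j} on the right gives (s ws^-1) eta_j^-1. The first factor is
    fixed, so it lies in Omega_{k_j} for large j, and the second lies in Y_{k_j}; the product is in
    Z_{k_j}, which inflation separates from the other blocks. *)
Lemma near_block_unique (k : nat -> nat) (eta : nat -> G) ws s :
  (forall j, (k j < k (S j))%nat) -> (forall j, Y (k j) (ginv (eta j))) ->
  exists N, forall j, (N <= j)%nat ->
    forall n, Y n (gmul (gmul s (ginv (gmul (gmul (v (k j)) (eta j)) ws))) (v n)) -> n = k j.
Proof.
  intros Hk He; destruct (OmegaN_eventually (gmul s (ginv ws))) as [N HN]; exists N.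
  intros j Hj n Hn; eapply Zset_disjoint; [apply Zset_Y, Hn|].
  replace (gmul _ (v (k j))) with (gmul (gmul s (ginv ws)) (ginv (eta j))) by grp.
  apply Zset_mul; [apply HN|apply He].
  pose proof (increasing_ge k Hk j); lia.
Qed.

End Combinatorics.

(** * Limit operators of the assembled operator *)

Section Main.
Context {G : group}.
Variable Om : G -> Prop.
Variable Y : nat -> G -> Prop.
Variable v : nat -> G.
Hypothesis Hcount : countable_group G.
Hypothesis Hgen : generates_semigroup G Om.
Hypothesis Hfin : forall n, finite_set G (Y n).
Hypothesis Hexh : exhausting Y.
Hypothesis Hinfl : inflating G (Zset G Om Y) v.
Variables (A : nat -> op G) (T B : op G).
Hypothesis HA : bseq G Y A.
Hypothesis HB : bounded G B.
Hypothesis HT : bounded G T.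
Hypothesis HAB : assembled Y v A B.
Hypothesis HAT : approximates Y A T.
Hypothesis HAT' : approximates Y (fun n => adj (A n)) (adj T).
Local Notation strong_lim := (Defs.strong_lim G).
Local Notation GP := (GammaPrime G Y v).

Let Hdisj := Y_disjoint Om Y v Hinfl.
Let HAB' := assembled_adj Y v Hdisj A B HA HAB.

Lemma shifted_limit_iff (k : nat -> nat) (g : nat -> G) S :
  (forall F, exists N, forall m, (N <= m)%nat -> inside F (ginv (g m)) (Y (k m))) ->
  (strong_lim (fun m => conjop (gmul (v (k m)) (g m)) B) S <->
   strong_lim (fun m => conjop (g m) T) S) /\
  (strong_lim (fun m => conjop (gmul (v (k m)) (g m)) (adj B)) (adj S) <->
   strong_lim (fun m => conjop (g m) (adj T)) (adj S)).
Proof.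
  intros Hg; split.
  - apply (strong_lim_shifted_block Y v A); assumption.
  - apply (strong_lim_shifted_block Y v (fun n => adj (A n))); auto using adj_bounded.
Qed.

Lemma inside_one (k : nat -> nat) (g : nat -> G) :
  (forall F, exists N, forall m, (N <= m)%nat -> inside F (ginv (g m)) (Y (k m))) ->
  exists N, forall m, (N <= m)%nat -> Y (k m) (ginv (g m)).
Proof.
  intros Hg; destruct (Hg [gone]) as [N HN]; exists N; intros m Hm.
  rewrite <- (gmul1l _ (ginv (g m))); apply HN; [exact Hm|left; reflexivity].
Qed.

(** Take h(m) = v_m w: the m-th block moves to Y_m w, and these sets exhaust G. *)
Lemma limop_of_shift w : limop_of G B (conjop w T).
Proof.
  exists (fun m => gmul (v m) w); apply is_limop_iff; [exact HB|].
  assert (Hg : forall F, exists N, forall m, (N <= m)%nat -> inside F (ginv w) (Y m))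
    by (intros F; apply Hexh).
  destruct (shifted_limit_iff (fun m => m) (fun _ => w) (conjop w T) Hg) as [H1 H2].
  split; [|split; [|split]].
  - apply (shifted_tends_to_infinity Om Y v Hinfl (fun m => m) (fun _ => w)); [auto|].
    apply (inside_one (fun m => m) (fun _ => w) Hg).
  - apply conjop_bounded, HT.
  - apply H1, strong_lim_const.
  - apply H2; eapply strong_lim_op_eq; [|apply strong_lim_const].
    intros x Hx t; symmetry; apply adj_conjop; assumption.
Qed.

(** A sequence g for A is lifted to v_{k m} g(m), with k m so large that the moved block Y_{k m}
    g(m) swallows every finite set despite the motion of g. *)
Lemma limop_of_limop S : limop_of G T S -> limop_of G B S.
Proof.
  intros [g Hg]; apply is_limop_iff in Hg; [|exact HT]; destruct Hg as [Hinf [HS [HS1 HS2]]].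
  destruct Hcount as [enum Henum].
  (* Y_k is to contain the products of the first m + 1 enumerated elements with g(m)^-1; every
     finite F is eventually among these elements. *)
  assert (Hk : forall m, exists k, (m <= k)%nat /\
     inside (map enum (seq 0 (Datatypes.S m))) (ginv (g m)) (Y k)).
  { intros m; destruct (Hexh (map enum (seq 0 (Datatypes.S m))) (ginv (g m))) as [N HN].
    exists (Nat.max m N); split; [lia|apply HN; lia]. }
  apply choice in Hk; destruct Hk as [k Hk].
  assert (Hin : forall F, exists N, forall m, (N <= m)%nat -> inside F (ginv (g m)) (Y (k m))).
  { intros F; apply (eventually_forall_list F (fun m f => Y (k m) (gmul f (ginv (g m))))).
    intros f _; destruct (Henum f) as [i <-]; exists i; intros m Hm.
    apply (Hk m), in_map, in_seq; lia. }
  destruct (shifted_limit_iff k g S Hin) as [H1 H2].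
  exists (fun m => gmul (v (k m)) (g m)); apply is_limop_iff; [exact HB|].
  split; [|split; [exact HS|split; [apply H1, HS1|apply H2, HS2]]].
  apply (shifted_tends_to_infinity Om Y v Hinfl); [intros m; apply (Hk m)|].
  apply (inside_one k g Hin).
Qed.

(** For each s, the point s h(m)^-1 eventually lies in no block, so the shifted column at s is
    eventually delta_s itself. *)
Lemma limit_far_from_blocks (h : nat -> G) S :
  (forall f, exists N, forall m, (N <= m)%nat ->
     forall k, ~ Y k (gmul (gmul f (ginv (h m))) (v k))) ->
  strong_lim (fun m => conjop (h m) B) S -> op_eq G S (opid G).
Proof.
  intros Hf HS; apply strong_lim_unique with (fun m => conjop (h m) B); [exact HS|].
  pose proof HB as HB0; rewrite bounded_iff in HB0; destruct HB0 as [M HM].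
  apply strong_lim_delta with (Rmax M 1).
  - intros m; apply conjop_bounded_by, (bounded_by_weaken _ M); [apply Rmax_l|exact HM].
  - apply (bounded_by_weaken _ 1); [apply Rmax_r|apply bounded_by_id].
  - intros s e He; destruct (Hf s) as [N HN]; exists N; intros m Hm.
    rewrite conjop_delta, (proj2 (HAB _)), RopInv_delta by (apply HN, Hm).
    replace (gmul (gmul s (ginv (h m))) (h m)) with s by grp.
    apply vnorm_le_self_sub; lra.
Qed.

(** Either g takes some value w infinitely often, and the constant subsequence determines the limit,
    or g takes each value only finitely often and so tends to infinity. *)
Lemma limit_deep_in_blocks (k : nat -> nat) (g : nat -> G) S :
  (forall F, exists N, forall m, (N <= m)%nat -> inside F (ginv (g m)) (Y (k m))) ->
  has_limop B (fun m => gmul (v (k m)) (g m)) S ->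
  (exists w, op_eq G S (conjop w T)) \/ limop_of G T S.
Proof.
  intros Hg [_ [HS [HS1 HS2]]].
  destruct (shifted_limit_iff k g S Hg) as [H1 H2].
  destruct (dec (exists w, forall N, exists m, (N <= m)%nat /\ g m = w)) as [[w Hw]|Hw].
  - left; exists w.
    destruct (subsequence_of (fun _ m => g m = w)) as [phi [Hphi Hgw]]; [intros _; exact Hw|].
    apply strong_lim_unique with (fun j => conjop (g (phi j)) T).
    + apply (strong_lim_subseq (fun m => conjop (g m) T)); [apply increasing_ge, Hphi|].
      apply H1, HS1.
    + replace (fun j => conjop (g (phi j)) T) with (fun _ : nat => conjop w T);
        [apply strong_lim_const|].
      apply functional_extensionality; intros j; rewrite Hgw; reflexivity.
  - right; exists g; apply is_limop_iff; [exact HT|].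
    split; [|split; [exact HS|split; [apply H1, HS1|apply H2, HS2]]].
    apply tends_to_infinity_of_ne; intros t; apply NNPP; intros Ht; apply Hw; exists t.
    intros N; destruct (not_eventually _ Ht N) as [m [Hm Hm']]; exists m; split; [exact Hm|].
    apply NNPP, Hm'.
Qed.

(** Only the sum of the block part and the shifted projection is known to converge. A diagonal
    subsequence makes the projections converge to that onto a set W, which forces the limit of the
    block part to be S minus this projection. *)
Lemma limit_at_boundary (k : nat -> nat) (eta : nat -> G) ws S :
  (forall j, (k j < k (Datatypes.S j))%nat) -> (forall j, Y (k j) (ginv (eta j))) ->
  has_limop B (fun j => gmul (gmul (v (k j)) (eta j)) ws) S ->
  exists phi : nat -> nat, (forall j, (phi j < phi (Datatypes.S j))%nat) /\
    exists Sl Pg,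
      strong_lim (fun j => opcomp G (RopInv G ws) (opcomp G (RopInv G (eta (phi j)))
         (opcomp G (A (k (phi j))) (opcomp G (proj G (Y (k (phi j))))
            (opcomp G (Rop G (eta (phi j))) (Rop G ws)))))) Sl /\
      is_limop G (proj G GP) (fun j => gmul (gmul (v (k (phi j))) (eta (phi j))) ws) Pg /\
      op_eq G S (opadd G Sl Pg).
Proof.
  intros Hk He HS; destruct Hcount as [enum Henum].
  set (h := fun j => gmul (gmul (v (k j)) (eta j)) ws) in *.
  destruct (diagonal_subsequence (fun j i => GP (gmul (enum i) (ginv (h j))))) as [phi [Hphi Hdiag]].
  exists phi; split; [exact Hphi|].
  pose proof (has_limop_subseq B h S phi (increasing_ge phi Hphi) HS) as [Hinf [HSb [HS1 _]]].
  (* The points s that eventually lie in the shifted Gamma'; by the choice of phi every other point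
     eventually lies outside it. *)
  set (W := fun s => exists N, forall j, (N <= j)%nat -> GP (gmul s (ginv (h (phi j))))).
  assert (HW : forall s, exists N, forall j, (N <= j)%nat ->
            (GP (gmul s (ginv (h (phi j)))) <-> W s)).
  { intros s; destruct (Henum s) as [i <-]; destruct (Hdiag i) as [[N HN]|[N HN]].
    - exists N; intros j Hj; split; [intros _; exists N; exact HN|intros _; apply HN, Hj].
    - exists N; intros j Hj; split; [intros H; elim (HN j Hj H)|].
      intros [N' HN']; elim (HN (Nat.max N N')); [lia|apply HN'; lia]. }
  assert (HP : strong_lim (fun j => conjop (h (phi j)) (proj G GP)) (proj G W)).
  { apply strong_lim_delta with 1.
    - intros j; apply conjop_bounded_by, bounded_by_proj.
    - apply bounded_by_proj.
    - intros s e He0; destruct (HW s) as [N HN]; exists N; intros j Hj; specialize (HN j Hj).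
      rewrite conjop_proj_delta; destruct (dec (GP _)) as [i|i].
      + rewrite proj_delta by tauto; apply vnorm_le_self_sub; lra.
      + rewrite proj_delta_out by tauto; apply vnorm_le_self_sub; lra. }
  exists (opsub G S (proj G W)), (proj G W); split; [|split].
  - set (D := fun j => opcomp G (RopInv G ws) (opcomp G (RopInv G (eta j))
         (opcomp G (A (k j)) (opcomp G (proj G (Y (k j))) (opcomp G (Rop G (eta j)) (Rop G ws)))))).
    change (strong_lim (fun j => D (phi j)) (opsub G S (proj G W))).
    pose proof HB as HB0; rewrite bounded_iff in HB0; destruct HB0 as [M HM].
    destruct (bseq_bounded_by Y A HA) as [M' [HM0' HM']].
    assert (HM0 : 0 <= M) by exact (proj1 (proj2 HM)).
    (* On each basis vector the block term and the difference of the shifted B and the shifted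
       projection agree exactly for large j; M + 1 + M' bounds both families. *)
    apply strong_lim_transfer with
      (fun j => opsub G (conjop (h (phi j)) B) (conjop (h (phi j)) (proj G GP))) (M + 1 + M').
    + intros j; apply bounded_by_weaken with (1 * (1 * (M' * (1 * (1 * 1))))); [lra|].
      repeat apply bounded_by_comp;
        auto using bounded_by_Rop, bounded_by_RopInv, bounded_by_proj.
    + intros j; apply bounded_by_weaken with (M + 1); [lra|].
      apply bounded_by_sub; apply conjop_bounded_by; auto using bounded_by_proj.
    + intros s e He0.
      destruct (near_block_unique Om Y v Hgen Hinfl k eta ws s Hk He) as [N HN]; exists N.
      intros j Hj; specialize (HN (phi j)).
      assert (Hpj : (N <= phi j)%nat) by (pose proof (increasing_ge phi Hphi j); lia).
      specialize (HN Hpj).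
      replace (D (phi j) (delta s)) with
        (opsub G (conjop (h (phi j)) B) (conjop (h (phi j)) (proj G GP)) (delta s));
        [apply vnorm_le_self_sub; lra|].
      change (gmul (gmul (v (k (phi j))) (eta (phi j))) ws) with (h (phi j)) in HN.
      set (i := phi j) in *; unfold opsub; rewrite conjop_proj_delta, conjop_delta.
      unfold D, opcomp; rewrite !Rop_delta.
      assert (E : gmul (gmul s (ginv (h i))) (v (k i)) = gmul (gmul s (ginv ws)) (ginv (eta i)))
        by (unfold h; grp).
      destruct (dec (GP (gmul s (ginv (h i))))) as [Hg|Hg].
      * rewrite GammaPrime_iff in Hg; rewrite (proj2 (HAB _) Hg), RopInv_delta.
        rewrite proj_delta_out by (rewrite <- E; apply Hg).
        rewrite (linear_zero (A (k i))) by apply HA.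
        replace (gmul (gmul s (ginv (h i))) (h i)) with s by grp.
        apply vec_ext; intros t; unfold Defs.vsub, RopInv, Rop, Defs.vzero; ring.
      (* A point outside Gamma' lies in some block, and for large j that can only be the block k
         i. *)
      * assert (Hy : Y (k i) (gmul (gmul s (ginv (h i))) (v (k i)))).
        { apply NNPP; intros Hy; apply Hg; apply GammaPrime_iff; intros n Hn; apply Hy.
          rewrite <- (HN n Hn) at 1; rewrite <- (HN n Hn); exact Hn. }
        rewrite (proj1 (HAB _) (k i) Hy), E, proj_delta by (rewrite <- E; exact Hy).
        unfold RopInv; rewrite !Rop_Rop.
        replace (gmul (ginv (h i)) (v (k i))) with (gmul (ginv ws) (ginv (eta i)))
          by (unfold h; grp).
        apply vec_ext; intros t; unfold Defs.vsub, Defs.vzero; ring.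
    + apply strong_lim_sub; [exact HS1|exact HP].
  - split; [exact Hinf|split; [|split; [exact HP|]]].
    + apply (bounded_by_bounded _ _ (bounded_by_proj W)).
    (* Orthogonal projections are self-adjoint, so the adjoint condition repeats the convergence
       already shown. *)
    + exists (proj G GP), (proj G W).
      repeat split; try apply proj_adjoint; try apply bounded_by_proj; try exact HP;
        exists 1; apply bounded_by_proj.
  - intros x Hx t; unfold opadd, opsub, Defs.vadd, Defs.vsub; ring.
Qed.

Lemma limop_cases S : limop_of G B S ->
  op_eq G S (opid G) \/ (exists w, op_eq G S (conjop w T)) \/ limop_of G T S \/
  exists (k : nat -> nat) (eta : nat -> G) (ws : G) (Sl Pg : op G),
    (forall j, (1 <= k j)%nat) /\ (forall j, (k j < k (Datatypes.S j))%nat) /\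
    (forall j, bd_Om G Om (Y (k j)) (ginv (eta j))) /\
    strong_lim (fun j => opcomp G (RopInv G ws) (opcomp G (RopInv G (eta j))
         (opcomp G (A (k j)) (opcomp G (proj G (Y (k j)))
            (opcomp G (Rop G (eta j)) (Rop G ws)))))) Sl /\
    is_limop G (proj G GP) (fun j => gmul (gmul (v (k j)) (eta j)) ws) Pg /\
    op_eq G S (opadd G Sl Pg).
Proof.
  intros [h Hh]; apply is_limop_iff in Hh; [|exact HB].
  destruct (dec (forall f, exists N, forall m, (N <= m)%nat ->
     forall k, ~ Y k (gmul (gmul f (ginv (h m))) (v k)))) as [Hfar|Hnear].
  { left; apply (limit_far_from_blocks h); [exact Hfar|apply Hh]. }
  right.
  assert (Hf : exists f, forall N, exists m, (N <= m)%nat /\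
            exists k, Y k (gmul (gmul f (ginv (h m))) (v k))).
  { apply NNPP; intros Hn; apply Hnear; intros f; apply NNPP; intros Hf; apply Hn; exists f.
    intros N; destruct (not_eventually _ Hf N) as [m [Hm Hm']]; exists m; split; [exact Hm|].
    apply NNPP; intros Hk; apply Hm'; intros k Hk'; apply Hk; exists k; exact Hk'. }
  destruct Hf as [f Hf].
  (* The shifted blocks keep returning to f. Finitely many finite blocks cannot account for this as
     h tends to infinity, so the block numbers can be made strictly increasing. *)
  destruct (joint_subsequence (fun _ m k => Y k (gmul (gmul f (ginv (h m))) (v k))))
    as [phi [k [Hphi [Hk [Hk1 Hfk]]]]].
  { intros _; apply (large_block_index Y v Hfin h f (proj1 Hh) Hf). }
  (* Chosen so that h(phi j) = v_{k j} g(j), which moves block k j to Y_{k j} g(j). *)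
  set (g := fun j => gmul (ginv (v (k j))) (h (phi j))).
  assert (Hg : has_limop B (fun j => gmul (v (k j)) (g j)) S).
  { replace (fun j => gmul (v (k j)) (g j)) with (fun j => h (phi j)).
    - apply has_limop_subseq; [apply increasing_ge, Hphi|exact Hh].
    - apply functional_extensionality; intros j; unfold g; grp. }
  assert (Hfg : forall j, Y (k j) (gmul f (ginv (g j)))).
  { intros j; specialize (Hfk j); unfold g; revert Hfk; grp; auto. }
  clearbody g; clear h Hh Hf Hnear Hphi Hfk phi.
  destruct (dec (forall F, exists N, forall m, (N <= m)%nat -> inside F (ginv (g m)) (Y (k m))))
    as [Hdeep|Hbd].
  { destruct (limit_deep_in_blocks k g S Hdeep Hg) as [|]; auto. }
  do 2 right.
  assert (HF : exists F, ~ exists N, forall m, (N <= m)%nat -> inside F (ginv (g m)) (Y (k m))).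
  { apply NNPP; intros Hn; apply Hbd; intros F; apply NNPP; intros HF; apply Hn; exists F; exact HF. }
  destruct HF as [F HF].
  destruct (pigeonhole F (fun f' m => ~ Y (k m) (gmul f' (ginv (g m))))) as [f' [_ Hf']].
  { intros N; destruct (not_eventually _ HF N) as [m [Hm Hm']]; exists m; split; [exact Hm|].
    apply NNPP; intros Hn; apply Hm'; intros f' Hf'; apply NNPP; intros Hn'; apply Hn.
    exists f'; auto. }
  (* The word l leads from f g(m)^-1, which is in Y (k m), to f' g(m)^-1, which is infinitely often
     outside. It does not depend on m, so one of its suffixes w yields a boundary point infinitely
     often. *)
  destruct (Hgen (gmul f' (ginv f))) as [l [_ [HOl Hl]]].
  destruct (pigeonhole (suffix_products l)
    (fun w m => bd_Om G Om (Y (k m)) (gmul w (gmul f (ginv (g m)))))) as [w [_ Hw]].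
  { intros N; destruct (Hf' N) as [m [Hm Hm']]; exists m; split; [exact Hm|].
    apply exit_point; auto.
    rewrite Hl; revert Hm'; grp; auto. }
  destruct (subsequence_of (fun _ m => bd_Om G Om (Y (k m)) (gmul w (gmul f (ginv (g m))))))
    as [psi [Hpsi Hb]]; [intros _; exact Hw|].
  (* The boundary point is eta_j^-1 = w f g^-1; with w_* = w f the product v eta_j w_* collapses to
     v g, so the sequence is unchanged. *)
  set (eta := fun j => ginv (gmul w (gmul f (ginv (g (psi j)))))).
  assert (Hb' : forall j, bd_Om G Om (Y (k (psi j))) (ginv (eta j)))
    by (intros j; unfold eta; rewrite ginv_ginv; apply Hb).
  destruct (limit_at_boundary (fun j => k (psi j)) eta (gmul w f) S)
    as [phi [Hphi [Sl [Pg [H1 [H2 H3]]]]]].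
  - apply increasing_comp; assumption.
  - intros j; apply (Hb' j).
  - replace (fun j => gmul (gmul (v (k (psi j))) (eta j)) (gmul w f))
      with (fun j => gmul (v (k (psi j))) (g (psi j))).
    + apply (has_limop_subseq B (fun j => gmul (v (k j)) (g j))); [apply increasing_ge, Hpsi|exact Hg].
    + apply functional_extensionality; intros j; unfold eta; grp.
  - exists (fun j => k (psi (phi j))), (fun j => eta (phi j)), (gmul w f), Sl, Pg.
    split; [intros j; apply Hk1|split; [|split; [intros j; apply Hb'|auto]]].
    apply (increasing_comp (fun j => k (psi j))); [apply increasing_comp|]; assumption.
Qed.

End Main.

Theorem mainTheorem11
  (Gam : group) (Hcount : countable_group Gam)
  (Om : Gam -> Prop) (HOmfin : finite_set Gam Om) (HOme : Om gone)
  (HOmgen : generates_semigroup Gam Om)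
  (Y : nat -> Gam -> Prop) (HYfin : forall n, finite_set Gam (Y n))
  (HYinc : forall n t, Y n t -> Y (S n) t) (HYunion : forall t, exists n, Y n t)
  (v : nat -> Gam) (Hinfl : inflating Gam (Zset Gam Om Y) v)
  (A : nat -> op Gam) (HA : SY Gam Y A)
  (Alim : op Gam) (HAlim : strong_lim Gam (fun n => opcomp Gam (A n) (proj Gam (Y n))) Alim)
  (OpA : op Gam) (HOpA : strong_lim Gam (op_partial Gam Y v A) OpA) :
  let B := opadd Gam OpA (proj Gam (GammaPrime Gam Y v)) in
  (forall Bh, limop_of Gam B Bh ->
     op_eq Gam Bh (opid Gam)
     \/ (exists vs : Gam, op_eq Gam Bh (opcomp Gam (RopInv Gam vs) (opcomp Gam Alim (Rop Gam vs))))
     \/ limop_of Gam Alim Bh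
     \/ (exists (k : nat -> nat) (eta : nat -> Gam) (ws : Gam) (Sl Pg : op Gam),
           (forall j, (1 <= k j)%nat) /\ (forall j, (k j < k (S j))%nat) /\
           (forall j, bd_Om Gam Om (Y (k j)) (ginv (eta j))) /\
           strong_lim Gam
             (fun j => opcomp Gam (RopInv Gam ws) (opcomp Gam (RopInv Gam (eta j))
                (opcomp Gam (A (k j)) (opcomp Gam (proj Gam (Y (k j)))
                   (opcomp Gam (Rop Gam (eta j)) (Rop Gam ws)))))) Sl /\
           is_limop Gam (proj Gam (GammaPrime Gam Y v))
             (fun j => gmul (gmul (v (k j)) (eta j)) ws) Pg /\
           op_eq Gam Bh (opadd Gam Sl Pg)))
  /\ (forall vs : Gam, limop_of Gam B (opcomp Gam (RopInv Gam vs) (opcomp Gam Alim (Rop Gam vs))))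
  /\ (forall Ah, limop_of Gam Alim Ah -> limop_of Gam B Ah).
Proof.
  intros B.
  pose proof (exhausting_of_union Y HYinc HYunion) as Hexh.
  destruct (SY_approximates Y A Alim Hexh HA HAlim) as [HAT HAT'].
  destruct (SY_local_star_seq Y A HA) as [Hb _].
  destruct (assembled_strong_lim Y v (Y_disjoint Om Y v Hinfl) A OpA Hb HOpA) as [HB HAB].
  assert (HT : bounded Gam Alim).
  { destruct (bseq_bounded_by Y A Hb) as [M [_ HM]].
    apply bounded_by_bounded with (M * 1).
    apply (strong_lim_bounded_by (fun n => opcomp Gam (A n) (proj Gam (Y n)))); [|exact HAlim].
    intros n; apply bounded_by_comp; [apply HM|apply bounded_by_proj]. }
  split; [|split].
  - intros Bh HBh; apply (limop_cases Om Y v) with B; assumption.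
  - intros vs; apply (limop_of_shift Om Y v) with A; assumption.
  - intros Ah HAh; apply (limop_of_limop Om Y v) with A Alim; assumption.
Qed.
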